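(* Suppose Assumptions 1, 2, 3 and 4 (stated in the context) hold, and let $$\omega_2 := \max\left\{\frac{96\sqrt n}{\eta\, c_{\rm all}^2},\ \|x^0\|_\infty\right\},\qquad \bar K_2 := \left\lceil \frac{1536\left(f(x^0)-f_{\rm low}+\mu n\left(\log(\omega_2)-\min_i\log(x^0_i)\right)\right)}{\eta\, c_{\rm all}^3}\,\epsilon_g^{-3/2}\right\rceil + 2 .$$ Suppose that the values of $M$ used or calculated at each instance of Algorithm CCG satisfy $M\le U_H+\mu$. Then with probability at least $(1-\delta)^{\bar K_2}$, Algorithm LBNCG terminates at a point $x$ satisfying $$x>0,\qquad \nabla f(x)\ge -\epsilon_g e,\qquad \|\bar X\nabla f(x)\|_\infty\le \epsilon_g,\qquad \bar X\nabla^2 f(x)\bar X\succeq -\epsilon_H I$$ after at most $$\left(\max\{2\min\{n,J(U_H+\mu,\epsilon_H,\zeta_r,c_\mu)\}+2,\ N_{\rm meo}\}\right)\bar K_2$$ Hessian-vector products and/or gradient evaluations. (With probability at most $1-(1-\delta)^{\bar K_2}$, it terminates incorrectly with this complexity at a point $x$ for which $x>0$, $\nabla f(x)\ge-\epsilon_ge$ and $\|\bar X\nabla f(x)\|_\infty\le\epsilon_g$ hold but $\bar X\nabla^2 f(x)\bar X\succeq-\epsilon_HI$ does not.)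
   Context: Problem and notation. The problem is to minimize $f(x)$ subject to $x\ge 0$, with $f:\mathbb R^n\to\mathbb R$. $\|\cdot\|$ is the Euclidean norm (or induced matrix norm), $e=(1,\dots,1)^\top$, $\lambda_{\min}$ is the smallest eigenvalue. For $x>0$ (componentwise): $X=\mathrm{diag}(x)$, $\bar x$ is the vector with components $\min(x_i,1)$, $\bar X=\mathrm{diag}(\bar x)$; $X_k,\bar X_k$ are these matrices at $x^k$. For $\mu>0$, $\phi_\mu(x)=f(x)-\mu\sum_{i=1}^n\log x_i$, so $\nabla\phi_\mu(x)=\nabla f(x)-\mu X^{-1}e$ and $\nabla^2\phi_\mu(x)=\nabla^2f(x)+\mu X^{-2}$. Algorithm CCG (Capped Conjugate Gradient). Inputs: symmetric $H\in\mathbb R^{n\times n}$, $g\ne0$, $\epsilon\in(0,1)$, $\zeta_r\in(0,1)$, $c_\mu\in(0,1)$, and $M\ge0$. Set $\bar H=H+2\epsilon I$, $\kappa=(M+2\epsilon)/\epsilon$, $\hat\zeta_r=\zeta_r/(3\kappa)$, $\tau=\sqrt\kappa/(\sqrt\kappa+1)$, $T=4\kappa^4/(1-\sqrt\tau)^2$; whenever $M$ is changed, $\kappa,\hat\zeta_r,\tau,T$ are recomputed. Set $y^0=0$, $r^0=g$, $p^0=-g$, $j=0$. If $(p^0)^\top\bar Hp^0<\epsilon\|p^0\|^2$, return $d=p^0$ with d_type=NC; else if $\|Hp^0\|>M\|p^0\|$ set $M\leftarrow\|Hp^0\|/\|p^0\|$. Then repeat: $a_j=\|r^j\|^2/((p^j)^\top\bar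 Hp^j)$, $y^{j+1}=y^j+a_jp^j$, $r^{j+1}=r^j+a_j\bar Hp^j$, $b_{j+1}=\|r^{j+1}\|^2/\|r^j\|^2$, $p^{j+1}=-r^{j+1}+b_{j+1}p^j$; $j\leftarrow j+1$; for the first $z$ in the order $p^j,y^j,r^j$ (if any) with $\|Hz\|>M\|z\|$, set $M\leftarrow\|Hz\|/\|z\|$; then apply the first applicable test: (1) if $(y^j)^\top\bar Hy^j<\epsilon\|y^j\|^2$ return $d=y^j$, d_type=NC; (2) if $\|r^j\|\le\hat\zeta_r\|r^0\|$ and $\|r^j\|_\infty\le c_\mu$ return $d=y^j$, d_type=SOL; (3) if $(p^j)^\top\bar Hp^j<\epsilon\|p^j\|^2$ return $d=p^j$, d_type=NC; (4) if $\|r^j\|>\sqrt T\tau^{j/2}\|r^0\|$, compute $a_j=\|r^j\|^2/((p^j)^\top\bar Hp^j)$ and $y^{j+1}=y^j+a_jp^j$, find $i\in\{0,\dots,j-1\}$ with $(y^{j+1}-y^i)^\top\bar H(y^{j+1}-y^i)<\epsilon\|y^{j+1}-y^i\|^2$, and return $d=y^{j+1}-y^i$, d_type=NC. Counting convention: the products $Hy^j$ and $Hr^j$ are obtained from the products $Hp^i$ through the CG recurrences without extra multiplications; the iterates $y^i$ may or may not be stored (if not, they are regenerated to find $i$ in test (4)). The index $J$: for a call of CCG with initial residual $r^0=g$, $J(M,\epsilon,\zeta_r,c_\mu)$ is the smallest integer $J$ such that $\sqrt T\tau^{J/2}\|r^0\|\le\min\{\hat\zeta_r\|r^0\|,c_\mu\}$,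 where $\hat\zeta_r,T,\tau$ are computed from $M,\epsilon,\zeta_r$ by the formulas $\kappa=(M+2\epsilon)/\epsilon$, $\hat\zeta_r=\zeta_r/(3\kappa)$, $\tau=\sqrt\kappa/(\sqrt\kappa+1)$, $T=4\kappa^4/(1-\sqrt\tau)^2$. In the claim, $J(U_H+\mu,\epsilon_H,\zeta_r,c_\mu)$ is understood as the largest such index over the calls of CCG made (with $r^0=\bar X_k\nabla\phi_\mu(x^k)$). Procedure MEO (minimum eigenvalue oracle). Inputs: symmetric $H$, $\epsilon>0$, optionally $M\ge\|H\|$. Output: either $\lambda\le-\epsilon/2$ and $v$ with $\|v\|=1$, $v^\top Hv=\lambda$ ($\lambda$ an estimate of $\lambda_{\min}(H)$), or a certificate that $\lambda_{\min}(H)\ge-\epsilon$; when output, the certificate is false with probability at most $\delta\in[0,1)$ (conditionally on the history up to that call). Algorithm LBNCG (Log-Barrier Newton-CG). Inputs: $\epsilon_g\in(0,1)$, $\theta\in(0,1)$, $x^0>0$, $\zeta_r\in(0,1)$, $\bar\zeta\in(0,1)$, $\beta\in[\epsilon_g^{1/2},1)$, $\eta\in(0,1)$; optionally $\hat M>0$ with $\|\nabla^2f(x)\|\le\hat M$ for all $x$ ($\hat M=0$ if not provided). Set $\epsilon_H=\epsilon_g^{1/2}$, $\mu=\epsilon_g/4$, $c_\mu=\bar\zeta\mu$, $M_\mu=\hat M+\mu$. For $k=0,1,2,\dots$: (i) If $[\nabla f(x^k)]_i\le-\epsilon_g$ for some $i$ or $\|\bar X_k\nabla f(x^k)\|_\infty>\epsilon_g$: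 call CCG with $H=\bar X_k\nabla^2\phi_\mu(x^k)\bar X_k$, $\epsilon=\epsilon_H$, $g=\bar X_k\nabla\phi_\mu(x^k)$, $\zeta_r$, $c_\mu$, $M=M_\mu$, obtaining $\hat d^k$ and d_type. If d_type=NC, $d^k=-\mathrm{sgn}(g^\top\hat d^k)\min\{|(\hat d^k)^\top H\hat d^k|/\|\hat d^k\|^3,\ \beta/\|X_k^{-1}\bar X_k\hat d^k\|_\infty\}\hat d^k$; if d_type=SOL, $d^k=\min\{1,\beta/\|X_k^{-1}\bar X_k\hat d^k\|_\infty\}\hat d^k$. (ii) Otherwise call MEO with $H=\bar X_k\nabla^2f(x^k)\bar X_k$, $\epsilon=\epsilon_H$, $M=\hat M$ (if provided). If it certifies $\lambda_{\min}(\bar X_k\nabla^2f(x^k)\bar X_k)\ge-\epsilon_H$, terminate; otherwise with the returned $v$ set $d^k=-\mathrm{sgn}(v^\top\bar X_k\nabla\phi_\mu(x^k))\min\{|v^\top\bar X_k\nabla^2\phi_\mu(x^k)\bar X_kv|,\ \beta/\|X_k^{-1}\bar X_kv\|_\infty\}v$. (iii) Line search: $\alpha_k=\theta^{j_k}$ with $j_k$ the smallest nonnegative integer such that $\phi_\mu(x^k+\alpha_k\bar X_kd^k)<\phi_\mu(x^k)-\frac\eta6\alpha_k^3\|d^k\|^3$; set $x^{k+1}=x^k+\alpha_k\bar X_kd^k$. Convention: $\mathrm{sgn}(0)\in\{-1,1\}$. The unit of computational cost is one Hessian-vector product or one gradient evaluation of $f$. Assumption 1: $f$ is twice uniformly Lipschitz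 continuously differentiable on an open neighborhood of the path of the iterates and trial points (a set containing the segments joining each $x^k$ to its trial points $x^k+\theta^j\bar X_kd^k$); $L_g$, $L_H>0$ are Lipschitz constants of $\nabla f$, $\nabla^2f$ there. Assumption 2: $f$ is bounded below by $f_{\rm low}$. Assumption 3: the iterates satisfy $\|\nabla f(x^k)\|\le U_g$, $\|\nabla^2f(x^k)\|\le U_H$ for some scalars $U_g>0$, $U_H>0$. Assumption 4: for every iteration $k$ at which LBNCG calls MEO, and for a specified failure probability $\delta$ with $0\le\delta\ll1$, MEO either certifies that $\bar X_k\nabla^2f(x^k)\bar X_k\succeq-\epsilon_HI$ or finds a vector of curvature smaller than $-\epsilon_H/2$ in at most $N_{\rm meo}:=\min\{n,1+\lceil\mathcal C_{\rm meo}\epsilon_H^{-1/2}\rceil\}$ Hessian-vector products, with probability $1-\delta$, where $\mathcal C_{\rm meo}$ depends at most logarithmically on $\delta$ and $\epsilon_H$. Constants: $c_d=\min\{\frac{1-\bar\zeta}9,(\frac3{2L_H})^{1/2},\frac1{2(L_H+9/2+\zeta_r)}\}$, $c_{\rm sol}=\min\{c_d,\frac{6(1-\beta)^2\theta^2}{(L_H+\eta)(1-\beta)^2+(2-\beta)}\}$, $c_{\rm nc}=\min\{1,\frac{3(1-\beta)^2\theta}{(L_H+\eta)(1-\beta)^2+(2-\beta)}\}$, $c_{\rm all}=\min\{c_{\rm sol},c_{\rm nc}\}$. *)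

(* Defs.v *)
From HB Require Import structures.
From mathcomp Require Import all_boot all_order all_algebra.
From mathcomp Require Import all_classical all_reals all_analysis.

Set Implicit Arguments.
Unset Strict Implicit.
Unset Printing Implicit Defensive.

Import Order.TTheory GRing.Theory Num.Theory numFieldNormedType.Exports.

Local Open Scope classical_set_scope.
Local Open Scope ring_scope.

Section EuclideanSpace.
Context {R : realType} {n : nat}.
Implicit Types (u v x : 'cV[R]_n) (A B : 'M[R]_n).

Definition dot u v : R := \sum_i u i 0 * v i 0.

(* The library norm `|v| on 'cV[R]_n is the sup norm ||v||_oo; the Euclidean
   norm has to be defined. *)
Definition enorm v : R := Num.sqrt (dot v v).

Definition qform A v : R := dot v (A *m v).

Definition opnorm A : R :=
  sup [set enorm (A *m v) | v in [set v | enorm v <= 1]].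

Definition psd A : Prop := A^T = A /\ forall v, 0 <= qform A v.

Definition loewner_ge A B : Prop := psd (A - B).

Definition gradient (f : 'cV[R]_n -> R) x : 'cV[R]_n :=
  \col_i 'D_(delta_mx i 0) f x.

Definition hessian (f : 'cV[R]_n -> R) x : 'M[R]_n :=
  \matrix_(i, j) 'D_(delta_mx j 0) (fun y => gradient f y i 0) x.

Definition twice_lipschitz_differentiable (f : 'cV[R]_n -> R)
    (N : set 'cV[R]_n) (Lg LH : R) : Prop :=
  [/\ forall x, N x -> differentiable (f : 'cV[R]_n -> R^o) x,
      forall x, N x -> differentiable (gradient f) x,
      forall x y, N x -> N y ->
        enorm (gradient f x - gradient f y) <= Lg * enorm (x - y) &
      forall x y, N x -> N y ->
        opnorm (hessian f x - hessian f y) <= LH * enorm (x - y)].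

Definition positive_vec x : Prop := forall i, 0 < x i 0.

(* X^-1 = diag(x)^-1 *)
Definition Xinv x : 'M[R]_n := diag_mx (\row_i (x i 0)^-1).

Definition Xbar x : 'M[R]_n := diag_mx (\row_i Num.min (x i 0) 1).

(* sgn(t), with sgn(0) either of -1 and 1 *)
Definition is_sgn (s t : R) : Prop :=
  (s = 1 /\ 0 <= t) \/ (s = -1 /\ t <= 0).

End EuclideanSpace.

Inductive dtype := NC | SOL.

(* [ccg_prods] is the number of Hessian-vector products spent by the call. *)
Record ccg_result (R : realType) (n : nat) := CCGResult {
  ccg_d : 'cV[R]_n;
  ccg_type : dtype;
  ccg_prods : nat }.

Record cg_state (R : realType) (n : nat) := CGState {
  cg_y : 'cV[R]_n;
  cg_r : 'cV[R]_n;
  cg_p : 'cV[R]_n;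
  cg_M : R }.

Section CCGConstants.
Context {R : realType}.
Variables (eps zeta_r : R).
Implicit Types M : R.

Definition kappa M : R := (M + 2 * eps) / eps.
Definition zeta_hat M : R := zeta_r / (3 * kappa M).
Definition tau M : R := Num.sqrt (kappa M) / (Num.sqrt (kappa M) + 1).
Definition bigT M : R := 4 * kappa M ^+ 4 / (1 - Num.sqrt (tau M)) ^+ 2.

(* sqrt(T) tau^(j/2) *)
Definition decay M (j : nat) : R :=
  Num.sqrt (bigT M) * tau M `^ (j%:R / 2).

Definition J_ok (cmu M r0 : R) (J : nat) : Prop :=
  decay M J * r0 <= Num.min (zeta_hat M * r0) cmu.

(* The smallest J with [J_ok], for r0 = ||r^0||.  No integer J <= 0
   qualifies, as decay M 0 >= 1 > zeta_hat M; hence nat. *)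
Definition J_index (cmu M r0 : R) : nat :=
  xget 0%N [set J | J_ok cmu M r0 J /\
                    forall J', J_ok cmu M r0 J' -> (J <= J')%N].

End CCGConstants.

Section CCG.
Context {R : realType} {n : nat}.
Variables (H : 'M[R]_n) (g : 'cV[R]_n) (eps zeta_r cmu M0 : R).

Definition Hbar : 'M[R]_n := H + (2 * eps)%:M.

Definition low_curv (z : 'cV[R]_n) : bool :=
  qform Hbar z < eps * enorm z ^+ 2.

(* Only the first violator in the list zs changes M. *)
Definition update_M (M : R) (zs : seq 'cV[R]_n) : R :=
  if [seq z <- zs | M * enorm z < enorm (H *m z)] is z :: _
  then enorm (H *m z) / enorm z else M.

Definition cg_init : cg_state R n :=
  CGState 0 g (- g) (if low_curv (- g) then M0 else update_M M0 [:: - g]).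

Definition cg_next (s : cg_state R n) : cg_state R n :=
  let a := enorm (cg_r s) ^+ 2 / qform Hbar (cg_p s) in
  let y := cg_y s + a *: cg_p s in
  let r := cg_r s + a *: (Hbar *m cg_p s) in
  let b := enorm r ^+ 2 / enorm (cg_r s) ^+ 2 in
  let p := - r + b *: cg_p s in
  CGState y r p (update_M (cg_M s) [:: p; y; r]).

(* The variables y^j, r^j, p^j and M when the tests of index j are applied,
   provided that the loop has not returned earlier. *)
Definition cg (j : nat) : cg_state R n := iter j cg_next cg_init.

(* The products H p^0, ..., H p^j are the only ones needed at index j, except
   that, when the residual decreases too slowly, the iterates y^i may have to
   be regenerated to find i, at the price of up to j further products.  That
   i exists is not assumed: were there none, the tests of index j would all
   fail and the loop would go on. *)
Definition ccg_test (j : nat) (res : ccg_result R n) : Prop :=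
  let s := cg j in let M := cg_M s in
  if j == 0%N then low_curv (cg_p s) /\ res = CCGResult (cg_p s) NC 1
  else if low_curv (cg_y s) then res = CCGResult (cg_y s) NC j.+1
  else if (enorm (cg_r s) <= zeta_hat eps zeta_r M * enorm g)
          && (`|cg_r s| <= cmu)
    then res = CCGResult (cg_y s) SOL j.+1
  else if low_curv (cg_p s) then res = CCGResult (cg_p s) NC j.+1
  else decay eps M j * enorm g < enorm (cg_r s) /\
       exists i prods,
         let d := cg_y (cg j.+1) - cg_y (cg i) in
         [/\ (i < j)%N, low_curv d, (j.+1 <= prods <= j.+1 + j)%N &
             res = CCGResult d NC prods].

Definition ccg_pending (j : nat) : Prop :=
  forall i, (i < j)%N -> forall res, ~ ccg_test i res.

Definition ccg_returns (res : ccg_result R n) : Prop :=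
  exists2 j, ccg_pending j & ccg_test j res.

Definition ccg_M_le (U : R) : Prop :=
  M0 <= U /\ forall j, ccg_pending j -> cg_M (cg j) <= U.

End CCG.

Record params (R : realType) := Params {
  eps_g : R;
  theta : R;
  zeta_r : R;
  zeta_bar : R;
  beta : R;
  decr_eta : R;
  Mhat : option R }.

(* What happens in one iteration.  In [CCGStep] and [MEOStep], d is the
   direction d^k and ls the line-search index j_k, with None if the line
   search goes on forever; [CCGLoop] is a call of CCG that never returns.
   In the MEO outcomes, prods is the number of Hessian-vector products spent
   by MEO. *)
Inductive outcome (R : realType) (n : nat) :=
| CCGStep of ccg_result R n & 'cV[R]_n & option nat
| CCGLoop
| MEOStep (lambda : R) (v : 'cV[R]_n) (prods : nat) (d : 'cV[R]_n)
    (ls : option nat)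
| MEOCert (prods : nat).
Arguments CCGLoop {R n}.
Arguments MEOCert {R n}.

(* Iterates and outcomes; only those of the iterations that are reached are
   meaningful. *)
Record run (R : realType) (n : nat) := Run {
  iterate : nat -> 'cV[R]_n;
  out : nat -> outcome R n }.

Section LBNCG.
Context {R : realType} {n : nat}.
Variables (f : 'cV[R]_n -> R) (P : params R).
Implicit Types (x d v : 'cV[R]_n) (o : outcome R n) (r : run R n).

Definition eps_H : R := Num.sqrt (eps_g P).
Definition mu : R := eps_g P / 4.
Definition c_mu : R := zeta_bar P * mu.
Definition M_mu : R := odflt 0 (Mhat P) + mu.

Definition phi x : R := f x - mu * \sum_i ln (x i 0).
Definition grad_phi x : 'cV[R]_n :=
  gradient f x - mu *: (Xinv x *m const_mx 1).
Definition hess_phi x : 'M[R]_n := hessian f x + mu *: (Xinv x *m Xinv x).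

Definition scaled_grad x : 'cV[R]_n := Xbar x *m grad_phi x.
Definition scaled_hess x : 'M[R]_n := Xbar x *m hess_phi x *m Xbar x.
Definition scaled_hess_f x : 'M[R]_n := Xbar x *m hessian f x *m Xbar x.

(* beta / ||X^-1 Xbar d||_oo *)
Definition max_step x d : R := beta P / `|Xinv x *m Xbar x *m d|.

Definition calls_ccg x : Prop :=
  (exists i, gradient f x i 0 <= - eps_g P) \/
  eps_g P < `|Xbar x *m gradient f x|.

Definition ccg_call_returns x : ccg_result R n -> Prop :=
  ccg_returns (scaled_hess x) (scaled_grad x) eps_H (zeta_r P) c_mu M_mu.

Definition ccg_direction x (res : ccg_result R n) d : Prop :=
  let dh := ccg_d res in
  match ccg_type res with
  | NC => exists2 s, is_sgn s (dot (scaled_grad x) dh) &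
      d = - (s * Num.min (`|qform (scaled_hess x) dh| / enorm dh ^+ 3)
                         (max_step x dh)) *: dh
  | SOL => d = Num.min 1 (max_step x dh) *: dh
  end.

Definition meo_direction x v d : Prop :=
  exists2 s, is_sgn s (dot v (scaled_grad x)) &
    d = - (s * Num.min `|qform (scaled_hess x) v| (max_step x v)) *: v.

Definition trial x d (j : nat) : 'cV[R]_n := x + theta P ^+ j *: (Xbar x *m d).

Definition decreases x d (j : nat) : Prop :=
  phi (trial x d j) <
    phi x - decr_eta P / 6 * (theta P ^+ j) ^+ 3 * enorm d ^+ 3.

Definition line_search x d (ls : option nat) : Prop :=
  match ls with
  | Some j => decreases x d j /\ forall i, (i < j)%N -> ~ decreases x d i
  | None => forall j, ~ decreases x d j
  end.

(* The outcome is one that an iteration started at x may have.  Nothing is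
   required of a certificate: it may be false. *)
Definition iteration_spec x o : Prop :=
  match o with
  | CCGStep res d ls =>
      [/\ calls_ccg x, ccg_call_returns x res, ccg_direction x res d &
          line_search x d ls]
  | CCGLoop => calls_ccg x /\ forall res, ~ ccg_call_returns x res
  | MEOStep lambda v _ d ls =>
      [/\ ~ calls_ccg x,
          [/\ lambda <= - eps_H / 2, enorm v = 1 &
              qform (scaled_hess_f x) v = lambda],
          meo_direction x v d & line_search x d ls]
  | MEOCert _ => ~ calls_ccg x
  end.

Definition direction o : option 'cV[R]_n :=
  match o with
  | CCGStep _ d _ | MEOStep _ _ _ d _ => Some d
  | _ => None
  end.

Definition next_iterate x o : option 'cV[R]_n :=
  match o with
  | CCGStep _ d (Some j) | MEOStep _ _ _ d (Some j) => Some (trial x d j)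
  | _ => None
  end.

Definition reached r (k : nat) : Prop :=
  forall j, (j < k)%N -> next_iterate (iterate r j) (out r j) <> None.

Definition is_run (x0 : 'cV[R]_n) r : Prop :=
  iterate r 0 = x0 /\
  forall k, reached r k ->
    iteration_spec (iterate r k) (out r k) /\
    forall y, next_iterate (iterate r k) (out r k) = Some y ->
              iterate r k.+1 = y.

Definition is_ccg o : bool :=
  match o with CCGStep _ _ _ | CCGLoop => true | _ => false end.

Definition terminates_at r (N : nat) : Prop :=
  reached r N /\ exists prods, out r N = MEOCert prods.

(* One gradient evaluation at x^k, plus the Hessian-vector products.  The
   value on CCGLoop is irrelevant: such an iteration never ends. *)
Definition cost o : nat :=
  match o with
  | CCGStep res _ _ => (ccg_prods res).+1
  | MEOStep _ _ prods _ _ | MEOCert prods => prods.+1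
  | CCGLoop => 0
  end.

Definition total_cost r (N : nat) : nat := (\sum_(k < N.+1) cost (out r k))%N.

(* J(U_H + mu, eps_H, zeta_r, c_mu): the largest index over the calls of CCG
   in the iterations 0, ..., N. *)
Definition J_max (UH : R) r (N : nat) : nat :=
  (\max_(k < N.+1 | is_ccg (out r k))
     J_index eps_H (zeta_r P) c_mu (UH + mu)
             (enorm (scaled_grad (iterate r k))))%N.

Definition assumption1 (Lg LH : R) r : Prop :=
  exists N : set 'cV[R]_n,
    [/\ open N,
        forall k, reached r k -> N (iterate r k),
        forall k d j (t : R), reached r k -> direction (out r k) = Some d ->
          0 <= t <= 1 ->
          N (iterate r k + t *: (trial (iterate r k) d j - iterate r k)) &
        twice_lipschitz_differentiable f N Lg LH].

Definition assumption2 (flow : R) : Prop := forall x, flow <= f x.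

Definition assumption3 (Ug UH : R) r : Prop :=
  forall k, reached r k ->
    enorm (gradient f (iterate r k)) <= Ug /\
    opnorm (hessian f (iterate r k)) <= UH.

Definition ccg_M_bounded (UH : R) r : Prop :=
  forall k, reached r k -> calls_ccg (iterate r k) ->
    ccg_M_le (scaled_hess (iterate r k)) (scaled_grad (iterate r k))
             eps_H (zeta_r P) c_mu M_mu (UH + mu).

Definition Mhat_valid : Prop :=
  forall M, Mhat P = Some M -> 0 < M /\ forall x, opnorm (hessian f x) <= M.

Definition first_order x : Prop :=
  [/\ positive_vec x, forall i, - eps_g P <= gradient f x i 0 &
      `|Xbar x *m gradient f x| <= eps_g P].

Definition second_order x : Prop :=
  loewner_ge (scaled_hess_f x) (- eps_H)%:M.

Definition N_meo (Cmeo : R) : nat :=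
  let c : R := Cmeo * eps_H `^ (- (1 / 2)) in
  minn n (1 + absz (Num.ceil c))%N.

Definition meo_prods o : option nat :=
  match o with
  | MEOStep _ _ prods _ _ | MEOCert prods => Some prods
  | _ => None
  end.

(* The call of MEO fails to deliver, within N_meo products, a direction of
   curvature at most -eps_H/2 (which [iteration_spec] guarantees for
   [MEOStep]) or a true certificate. *)
Definition meo_fails (Cmeo : R) x o : Prop :=
  match o with
  | MEOStep _ _ prods _ _ => (N_meo Cmeo < prods)%N
  | MEOCert prods => (N_meo Cmeo < prods)%N \/ ~ second_order x
  | _ => False
  end.

Definition terminates_within (Cmeo UH : R) (K : nat) (Q : 'cV[R]_n -> Prop) r
    : Prop :=
  exists N, [/\ terminates_at r N, Q (iterate r N) &
    (total_cost r N <=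
       maxn (2 * minn n (J_max UH r N) + 2) (N_meo Cmeo) * K)%N].

Definition c_d (LH : R) : R :=
  Num.min ((1 - zeta_bar P) / 9)
    (Num.min (Num.sqrt (3 / (2 * LH))) (1 / (2 * (LH + 9 / 2 + zeta_r P)))).

Definition c_denom (LH : R) : R :=
  (LH + decr_eta P) * (1 - beta P) ^+ 2 + (2 - beta P).

Definition c_sol (LH : R) : R :=
  Num.min (c_d LH) (6 * (1 - beta P) ^+ 2 * theta P ^+ 2 / c_denom LH).

Definition c_nc (LH : R) : R :=
  Num.min 1 (3 * (1 - beta P) ^+ 2 * theta P / c_denom LH).

Definition c_all (LH : R) : R := Num.min (c_sol LH) (c_nc LH).

Definition omega2 (LH : R) (x0 : 'cV[R]_n) : R :=
  Num.max (96 * Num.sqrt n%:R / (decr_eta P * c_all LH ^+ 2)) `|x0|.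

Definition K2_real (LH flow : R) (x0 : 'cV[R]_n) : R :=
  1536 * (f x0 - flow + mu * n%:R *
            (ln (omega2 LH x0) - inf (range (fun i : 'I_n => ln (x0 i 0)))))
  / (decr_eta P * c_all LH ^+ 3) * eps_g P `^ (- (3 / 2)).

(* K2_real is nonnegative when flow <= f x0, n > 0 and x0 > 0: [absz] is only
   a cast from int to nat. *)
Definition K2 (LH flow : R) (x0 : 'cV[R]_n) : nat :=
  (absz (Num.ceil (K2_real LH flow x0)) + 2)%N.

End LBNCG.
Arguments N_meo {R} n P Cmeo.

Definition at_most_logarithmic {R : realType} (Cmeo : R -> R -> R) : Prop :=
  (forall delta eps, 0 <= delta < 1 -> 0 < eps < 1 -> 0 <= Cmeo delta eps) /\
  exists A B : R, forall delta eps, 0 < delta < 1 -> 0 < eps < 1 ->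
    Cmeo delta eps <= A + B * (`|ln delta| + `|ln eps|).

Section RandomRuns.
Context {R : realType} {n : nat}.
Variables (f : 'cV[R]_n -> R) (P : params R) (Cmeo : R).
Context {dsp : measure_display} {Omega : measurableType dsp}.
Variables (Pr : probability Omega R) (X : Omega -> run R n).

Definition iterate_in (k : nat) (i : 'I_n) (B : set R) : set Omega :=
  [set w | reached P (X w) k /\ B (iterate (X w) k i 0)].

Definition meo_called (k : nat) : set Omega :=
  [set w | reached P (X w) k /\ ~~ is_ccg (out (X w) k)].

Definition meo_failed (k : nat) : set Omega :=
  [set w | reached P (X w) k /\
           meo_fails f P Cmeo (iterate (X w) k) (out (X w) k)].

(* The sigma-algebra of the history up to the call of MEO in iteration k. *)
Definition history (k : nat) : set (set Omega) :=
  <<s [set E | [\/ exists j i B, [/\ (j <= k)%N, measurable B &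
                                     E = iterate_in j i B],
                   exists2 j, (j <= k)%N & E = meo_called j |
                   exists2 j, (j < k)%N & E = meo_failed j]] >>.

(* The conditional probability, given the history, that a call of MEO fails
   is at most delta. *)
Definition assumption4 (delta : R) : Prop :=
  (forall k, history k `<=` measurable) /\
  forall k E, history k E -> E `<=` meo_called k ->
    (Pr (E `&` meo_failed k) <= delta%:E * Pr E)%E.

(* Probability bounds on the event A, up to enclosing A by measurable events;
   for A measurable they read p <= Pr A and Pr A <= p. *)
Definition prob_ge (A : set Omega) (p : R) : Prop :=
  exists B, [/\ measurable B, B `<=` A & (p%:E <= Pr B)%E].

Definition prob_le (A : set Omega) (p : R) : Prop :=
  exists B, [/\ measurable B, A `<=` B & (Pr B <= p%:E)%E].

End RandomRuns.

(* Main.v *)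
(* Each iteration that takes a step moves by some length s and decreases the
   barrier function phi_mu by more than eta s^3 / 6.  With t = c_all eps_H / 4,
   every step has s >= t, except possibly a unit step along an approximate
   solution returned by CCG; after such a short step the first-order conditions
   hold, so the next iteration calls MEO.

   The logarithms are controlled by the tangent inequality at omega_2,
   ln x_i <= ln omega_2 + x_i / omega_2 - 1: adding (mu / omega_2) sum_i x_i to
   phi_mu gives a merit function that is bounded below, and by the choice of
   omega_2 it loses more than eta (s^3 / 6 - t^2 s / 24) per step, which is at
   least 3 u for a long step and at least - u for a short one, u = eta t^3 / 24.
   Hence (3 g - b) u < (initial gap) for g long and b <= g + 1 short steps,
   which bounds the number of iterations by K_2.

   CCG stops after min(n, J) iterations because the residuals are orthogonal
   and because an estimate sequence yields the linear rate tau^j as long as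
   q is eps-strongly convex along the differences y^{j+1} - y^i.  The
   probability bound multiplies the conditional success probabilities of MEO. *)

Require Import Defs.
From HB Require Import structures.
From mathcomp Require Import all_boot all_order all_algebra.
From mathcomp Require Import all_classical all_reals all_analysis.
From mathcomp Require Import ring lra zify.

Set Implicit Arguments.
Unset Strict Implicit.
Unset Printing Implicit Defensive.

Import Order.TTheory GRing.Theory Num.Theory numFieldNormedType.Exports.

Local Open Scope classical_set_scope.
Local Open Scope ring_scope.

(** * Euclidean norm *)

Section Euclid.
Context {R : realType} {n : nat}.
Implicit Types (u v w x : 'cV[R]_n) (A B : 'M[R]_n) (a : R).

(** [phi] itself may be unbounded below: f is only bounded below, no level set is assumed bounded,
    and the logarithms grow with x. The linear term added in [merit] repairs this. Its price is
    linear in the step length s whereas the descent is cubic in s, so only short steps can raise the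
    merit function.

    All estimates before the probabilistic part concern a single run. A slow call of MEO or a false
    certificate affects the cost or the final point but never the descent, because [iteration_spec]
    gives every direction returned by MEO its curvature. Randomness enters only through the event
    that no call of MEO fails before index K_2.

    The conjugate gradient identities also rest on symmetry, which the definition of [hessian] does
    not contain; it is recovered from the Lipschitz continuity of the Hessian. *)

Lemma dotC u v : dot u v = dot v u.
Proof. by apply: eq_bigr => i _; rewrite mulrC. Qed.

Lemma dotDl u v w : dot (u + v) w = dot u w + dot v w.
Proof. by rewrite -big_split; apply: eq_bigr => i _; rewrite mxE mulrDl. Qed.

Lemma dotZl a u v : dot (a *: u) v = a * dot u v.
Proof. by rewrite /dot mulr_sumr; apply: eq_bigr => i _; rewrite mxE mulrA. Qed.

Lemma dotNl u v : dot (- u) v = - dot u v.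
Proof. by rewrite -scaleN1r dotZl mulN1r. Qed.

Lemma dotBl u v w : dot (u - v) w = dot u w - dot v w.
Proof. by rewrite dotDl dotNl. Qed.

Lemma dotDr u v w : dot w (u + v) = dot w u + dot w v.
Proof. by rewrite dotC dotDl !(dotC w). Qed.

Lemma dotZr a u v : dot u (a *: v) = a * dot u v.
Proof. by rewrite dotC dotZl dotC. Qed.

Lemma dotNr u v : dot u (- v) = - dot u v.
Proof. by rewrite dotC dotNl dotC. Qed.

Lemma dotBr u v w : dot w (u - v) = dot w u - dot w v.
Proof. by rewrite dotDr dotNr. Qed.

Lemma dot0l v : dot 0 v = 0.
Proof. by rewrite -(scale0r 0) dotZl mul0r. Qed.

Lemma dot0r v : dot v 0 = 0.
Proof. by rewrite dotC dot0l. Qed.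

Lemma dot_ge0 v : 0 <= dot v v.
Proof. by apply: sumr_ge0 => i _; rewrite -expr2 sqr_ge0. Qed.

Lemma dot_eq0 v : (dot v v == 0) = (v == 0).
Proof.
apply/eqP/eqP => [v0|->]; last exact: dot0l.
apply/matrixP => i j; rewrite ord1 mxE; apply/eqP.
rewrite -sqrf_eq0 expr2; apply/eqP.
by apply: (psumr_eq0P _ v0) => // k _; rewrite -expr2 sqr_ge0.
Qed.

Lemma dot_trmx A u v : dot (A *m u) v = dot u (A^T *m v).
Proof.
rewrite /dot; under eq_bigr do rewrite mxE mulr_suml.
rewrite exchange_big; apply: eq_bigr => i _; rewrite mxE mulr_sumr.
by apply: eq_bigr => j _; rewrite mxE; ring.
Qed.

Lemma dot_sym A u v : A^T = A -> dot (A *m u) v = dot u (A *m v).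
Proof. by move=> As; rewrite dot_trmx As. Qed.

Lemma enorm_ge0 v : 0 <= enorm v.
Proof. exact: sqrtr_ge0. Qed.

Lemma sqr_enorm v : enorm v ^+ 2 = dot v v.
Proof. by rewrite sqr_sqrtr ?dot_ge0. Qed.

Lemma enorm_eq0 v : (enorm v == 0) = (v == 0).
Proof. by rewrite -sqrf_eq0 sqr_enorm dot_eq0. Qed.

Lemma enorm_gt0 v : (0 < enorm v) = (v != 0).
Proof. by rewrite lt_neqAle enorm_ge0 andbT eq_sym enorm_eq0. Qed.

Lemma enormZ a v : enorm (a *: v) = `|a| * enorm v.
Proof. by rewrite /enorm dotZl dotZr mulrA -expr2 sqrtrM ?sqr_ge0// sqrtr_sqr. Qed.

Lemma enormN v : enorm (- v) = enorm v.
Proof. by rewrite -scaleN1r enormZ normrN1 mul1r. Qed.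

Lemma enorm0 : enorm (0 : 'cV[R]_n) = 0.
Proof. by apply/eqP; rewrite enorm_eq0. Qed.

Lemma cauchy_schwarz u v : dot u v <= enorm u * enorm v.
Proof.
have [->|v0] := eqVneq v 0; first by rewrite dot0r enorm0 mulr0.
have [->|u0] := eqVneq u 0; first by rewrite dot0l enorm0 mul0r.
have := dot_ge0 (enorm v *: u - enorm u *: v).
rewrite dotBl !dotBr !dotZl !dotZr (dotC v u) -!sqr_enorm => h.
rewrite -(ler_pM2l (_ : 0 < enorm u * enorm v)) ?mulr_gt0 ?enorm_gt0//.
lra.
Qed.

Lemma normr_dot_le u v : `|dot u v| <= enorm u * enorm v.
Proof.
by rewrite ler_norml cauchy_schwarz andbT lerNl -dotNl -(enormN u) cauchy_schwarz.
Qed.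

Lemma enormD u v : enorm (u + v) <= enorm u + enorm v.
Proof.
rewrite -(ler_pXn2r (_ : 0 < 2)%N)// ?nnegrE ?addr_ge0 ?enorm_ge0//.
rewrite sqr_enorm dotDl !dotDr (dotC v u) sqrrD -!sqr_enorm.
have := cauchy_schwarz u v; lra.
Qed.

Lemma coord_sqr_le v i : v i 0 ^+ 2 <= dot v v.
Proof.
rewrite /dot (bigD1 i)//= -expr2 lerDl.
by apply: sumr_ge0 => j _; rewrite -expr2 sqr_ge0.
Qed.

Lemma coord_le_enorm v i : `|v i 0| <= enorm v.
Proof.
rewrite -(ler_pXn2r (_ : 0 < 2)%N)// ?nnegrE ?enorm_ge0//.
by rewrite real_normK ?num_real// sqr_enorm coord_sqr_le.
Qed.

Lemma coord_le_norm v i : `|v i 0| <= `|v|.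
Proof.
by rewrite [leRHS]/Num.Def.normr/= mx_normrE; apply/bigmax_geP; right; exists (i, 0).
Qed.

Lemma norm_le_coord v a : 0 <= a -> (forall i, `|v i 0| <= a) -> `|v| <= a.
Proof.
move=> a0 va; rewrite [leLHS]/Num.Def.normr/= mx_normrE.
by apply: bigmax_le => // -[i j] _ /=; rewrite ord1.
Qed.

Lemma norm_le_enorm v : `|v| <= enorm v.
Proof. by apply: norm_le_coord => [|i]; [exact: enorm_ge0|exact: coord_le_enorm]. Qed.

Lemma enorm_le_coord u v : (forall i, `|u i 0| <= `|v i 0|) -> enorm u <= enorm v.
Proof.
move=> uv; rewrite /enorm ler_wsqrtr// /dot ler_sum// => i _.
by rewrite -!expr2 -(real_normK (num_real (u i 0))) -(real_normK (num_real (v i 0)))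
  ler_pXn2r ?nnegrE.
Qed.

(** Cauchy-Schwarz against the all-ones vector. It turns the length of a step into a bound on the
    growth of the linear term of [merit]. *)
Lemma sum_le_enorm v : \sum_i v i 0 <= Num.sqrt n%:R * enorm v.
Proof.
have := cauchy_schwarz (const_mx 1) v.
rewrite /enorm {1 2}/dot; under eq_bigr do rewrite mxE mul1r.
under [X in Num.sqrt X]eq_bigr do rewrite mxE mul1r.
by rewrite sumr_const card_ord.
Qed.

Lemma sum_cube_le_enorm v : \sum_i `|v i 0| ^+ 3 <= enorm v ^+ 3.
Proof.
rewrite exprS sqr_enorm /dot mulr_sumr; apply: ler_sum => i _.
by rewrite exprS real_normK ?num_real// -expr2 ler_wpM2r ?sqr_ge0 ?coord_le_enorm.
Qed.

(** The Frobenius norm is an upper bound. Only with such a bound does [sup] in [opnorm] mean a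
    supremum and not a default value. *)
Lemma has_sup_opnorm A : has_sup [set enorm (A *m v) | v in [set v | enorm v <= 1]].
Proof.
split; first by exists (enorm (A *m 0)), 0 => //=; rewrite enorm0.
exists (Num.sqrt (\sum_i dot (row i A)^T (row i A)^T)) => _ [v /= v1 <-].
rewrite /enorm ler_wsqrtr// {1}/dot ler_sum// => i _.
have -> : (A *m v) i 0 = dot (row i A)^T v.
  by rewrite mxE; apply: eq_bigr => j _; rewrite !mxE.
rewrite -expr2 -real_normK ?num_real// -sqr_enorm ler_pXn2r ?nnegrE ?enorm_ge0//.
by apply: le_trans (normr_dot_le _ _) _; rewrite ler_piMr ?enorm_ge0.
Qed.

Lemma opnorm_ge0 A : 0 <= opnorm A.
Proof.
apply: sup_upper_bound; first exact: has_sup_opnorm.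
by exists 0; rewrite /= ?mulmx0 ?enorm0.
Qed.

Lemma enorm_mulmx_le A v : enorm (A *m v) <= opnorm A * enorm v.
Proof.
have [->|v0] := eqVneq v 0; first by rewrite mulmx0 enorm0 mulr0.
have v_gt0 : 0 < enorm v by rewrite enorm_gt0.
rewrite -ler_pdivrMr//.
apply: sup_upper_bound; first exact: has_sup_opnorm.
exists ((enorm v)^-1 *: v) => /=.
  by rewrite enormZ ger0_norm ?invr_ge0 ?enorm_ge0// mulVf ?gt_eqF.
by rewrite -scalemxAr enormZ ger0_norm ?invr_ge0 ?enorm_ge0// mulrC.
Qed.

Lemma dot_mulmx_le A u v : dot u (A *m v) <= opnorm A * (enorm u * enorm v).
Proof.
apply: le_trans (cauchy_schwarz _ _) _.
by rewrite mulrCA ler_wpM2l ?enorm_ge0// enorm_mulmx_le.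
Qed.

Lemma qform_le A v : qform A v <= opnorm A * enorm v ^+ 2.
Proof. by rewrite expr2; exact: dot_mulmx_le. Qed.

Lemma qformZ A a v : qform A (a *: v) = a ^+ 2 * qform A v.
Proof. by rewrite /qform -scalemxAr dotZl dotZr mulrA expr2. Qed.

Lemma mul_diag_col (d : 'rV[R]_n) v i : (diag_mx d *m v) i 0 = d 0 i * v i 0.
Proof. by rewrite mul_diag_mx mxE. Qed.

Lemma dot_diag (d : 'rV[R]_n) u v : dot (diag_mx d *m u) v = dot u (diag_mx d *m v).
Proof. by rewrite dot_sym ?tr_diag_mx. Qed.

End Euclid.

(** * Taylor bounds and symmetry of the Hessian *)

Section RealAnalysis.
Context {R : realType}.
Implicit Types (h dh : R -> R) (a b c t : R).

Lemma derive_ge0_le h dh a b : a <= b ->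
  (forall t, a <= t <= b -> is_derive t 1 h (dh t)) ->
  (forall t, a <= t <= b -> 0 <= dh t) -> h a <= h b.
Proof.
move=> ab hdh dh_ge0.
have hc : {within `[a, b], continuous h}.
  by apply: derivable_within_continuous => t; rewrite in_itv/= => /hdh ht; exact: ex_derive.
have [|c] := @MVT_segment R h dh a b ab _ hc.
  by move=> t; rewrite in_itv/= => /andP[? ?]; apply: hdh; rewrite !ltW.
rewrite in_itv/= => /dh_ge0 ? e.
by rewrite -subr_ge0 e mulr_ge0// subr_ge0.
Qed.

(** Monotonicity of h minus the primitive of the quadratic replaces an integral remainder. All
    Taylor bounds below are obtained from it. *)
Lemma derive_le_quadratic h dh a b c :
  (forall t, 0 <= t <= 1 -> is_derive t 1 h (dh t)) ->
  (forall t, 0 <= t <= 1 -> dh t <= a + b * t + c * t ^+ 2) ->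
  h 1 - h 0 <= a + b / 2 + c / 3.
Proof.
move=> hdh le_dh.
pose q : {poly R} := c / 3 *: 'X^3 + b / 2 *: 'X^2 + a *: 'X.
have qE t : q.[t] = a * t + b / 2 * t ^+ 2 + c / 3 * t ^+ 3.
  by rewrite /q !hornerE; ring.
have dqE t : (deriv q).[t] = a + b * t + c * t ^+ 2.
  by rewrite /q !poly.derivE !hornerE/=; field.
have : (horner q - h) 0 <= (horner q - h) 1.
  apply: (@derive_ge0_le _ (fun t => (deriv q).[t] - dh t)) => // t t01.
    by have ht := hdh t t01; exact: is_deriveB.
  by rewrite dqE subr_ge0 le_dh.
by rewrite !fctE !qE !expr0n/= !expr1n; lra.
Qed.

Lemma Nln_le t b : `|t| <= b -> b < 1 ->
  - ln (1 + t) <= - t + t ^+ 2 / 2 + `|t| ^+ 3 / (3 * (1 - b)).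
Proof.
move=> tb b1.
have st_ge (s : R) : 0 <= s <= 1 -> 1 - b <= 1 + t * s.
  move=> /andP[s0 s1]; have : `|t * s| <= b.
    by rewrite normrM (ger0_norm s0) (le_trans _ tb)// ler_piMr.
  by rewrite ler_norml => /andP[? _]; lra.
have st_gt0 (s : R) : 0 <= s <= 1 -> 0 < 1 + t * s.
  by move=> /st_ge; apply: lt_le_trans; rewrite subr_gt0.
have dl (s : R) : 0 <= s <= 1 ->
    is_derive s 1 (fun s : R => - ln (1 + t * s)) (- (1 + t * s)^-1 * t).
  move=> s01; have dt : is_derive s 1 (fun s : R => 1 + t * s) t.
    have -> : (fun s : R => 1 + t * s) = cst 1 + t *: (id : R -> R) by [].
    have := is_deriveD (is_derive_cst (1 : R) s 1) (is_deriveZ t (is_derive_id s (1 : R))).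
    by rewrite add0r /GRing.scale/= mulr1.
  have := @is_derive1_comp R (@ln R) _ s _ t (is_derive1_ln (st_gt0 _ s01)) dt.
  by move/is_deriveN; rewrite mulNr.
have := @derive_le_quadratic _ _ (- t) (t ^+ 2) (`|t| ^+ 3 / (1 - b)) dl.
rewrite !mulr1 !mulr0 addr0 ln1 oppr0 subr0 => h; apply: le_trans (h _) _ => [s s01|].
-  have := st_gt0 s s01; have := st_ge s s01; set w := 1 + t * s => wb w0.
  (* Geometric expansion of the derivative to second order. The remainder is bounded through w >= 1
     - b, and the primitive of s^2 yields the factor 3 of the statement. *)
  have -> : - w^-1 * t = - t + t ^+ 2 * s - t ^+ 3 * s ^+ 2 / w.
    by rewrite /w in w0 *; field; exact: lt0r_neq0.
  rewrite lerD2l.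
  rewrite -mulNr -mulNr; apply: le_trans (_ : `|t| ^+ 3 * s ^+ 2 / w <= _).
    rewrite ler_pM2r ?invr_gt0// ler_wpM2r ?sqr_ge0// -normrX -normrN.
    exact: ler_norm.
  rewrite [leRHS]mulrAC ler_wpM2l//.
    by apply: mulr_ge0; [exact: exprn_ge0|exact: sqr_ge0].
  by rewrite lef_pV2 ?posrE ?subr_gt0.
- by rewrite invfM; lra.
Qed.

End RealAnalysis.

(** * Taylor expansion of f and its gradient along a segment *)

Section Taylor.
Context {R : realType} {n : nat}.
Implicit Types (x y p u v : 'cV[R]_n).

Lemma derive_gradient (f : 'cV[R]_n -> R) x p :
  differentiable (f : 'cV[R]_n -> R^o) x -> 'D_p f x = dot (gradient f x) p.
Proof.
move=> df; rewrite deriveE//.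
have -> : p = \sum_i p i 0 *: delta_mx i 0.
  by rewrite [LHS]matrix_sum_delta; apply: eq_bigr => i _; rewrite big_ord1.
rewrite linear_sum /dot; apply: eq_bigr => i _; rewrite linearZ /= -deriveE//.
rewrite mxE mulrC; congr (_ * _).
rewrite summxE (bigD1 i)//= !mxE !eqxx mulr1 big1 ?addr0// => j ji.
by rewrite !mxE [i == j]eq_sym (negbTE ji) mulr0.
Qed.

Lemma is_derive_line (f : 'cV[R]_n -> R) x p (t : R) :
  differentiable (f : 'cV[R]_n -> R^o) (x + t *: p) ->
  is_derive t (1 : R) (fun s : R => f (x + s *: p) : R^o)
    (dot (gradient f (x + t *: p)) p).
Proof.
move=> df; rewrite -derive_gradient//.
have dp : derivable f (x + t *: p) p by exact: diff_derivable.
have e : (fun h : R => h^-1 *: (((fun s : R => f (x + s *: p)) \o shift t) (h *: (1 : R)) -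
    f (x + t *: p))) =
  (fun h : R => h^-1 *: ((f \o shift (x + t *: p)) (h *: p) - f (x + t *: p))).
  apply/funext => h /=; congr (_ *: (f _ - _)).
  by rewrite scalerDl addrCA -scalerA scale1r.
by apply: DeriveDef; rewrite /derivable /derive e.
Qed.

Lemma is_derive_gradient_line (f : 'cV[R]_n -> R) x p u (t : R) :
  differentiable (gradient f) (x + t *: p) ->
  is_derive t (1 : R) (fun s : R => dot u (gradient f (x + s *: p)) : R^o)
    (dot u (hessian f (x + t *: p) *m p)).
Proof.
move=> df.
have dfi i : differentiable ((fun y => gradient f y i 0) : 'cV[R]_n -> R^o) (x + t *: p).
  exact: (differentiable_comp df (differentiable_coord _ i 0)).
have -> : (fun s : R => dot u (gradient f (x + s *: p))) =
    \sum_i (u i 0 *: (fun s : R => gradient f (x + s *: p) i 0 : R^o)).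
  by apply/funext => s; rewrite fct_sumE.
rewrite /dot; apply: is_derive_sum => i; apply: is_deriveZ.
apply: is_derive_eq; first exact: (is_derive_line (dfi i)).
by rewrite [RHS]mxE; apply: eq_bigr => j _; rewrite !mxE.
Qed.

Variables (f : 'cV[R]_n -> R) (N : set 'cV[R]_n) (Lg LH : R).
Hypothesis fN : twice_lipschitz_differentiable f N Lg LH.

(** Pairing the gradient with a fixed u makes the claim scalar, so that the one-dimensional
    comparison applies to t -> u^T grad f(x + t p). *)
Lemma taylor_gradient x p u : (forall t : R, 0 <= t <= 1 -> N (x + t *: p)) ->
  dot u (gradient f (x + p)) <=
    dot u (gradient f x) + dot u (hessian f x *m p) + LH / 2 * enorm p ^+ 2 * enorm u.
Proof.
case: fN => _ dg _ hlip xpN.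
have Nx : N x by have := xpN 0; rewrite scale0r addr0 lexx ler01; exact.
have := derive_le_quadratic (fun t t01 => is_derive_gradient_line u (dg _ (xpN t t01)))
  (a := dot u (hessian f x *m p)) (b := LH * enorm p ^+ 2 * enorm u) (c := 0).
rewrite scale0r addr0 scale1r mul0r addr0 => h.
rewrite -addrA -lerBlDl; apply: le_trans (h _) _; last by lra.
move=> t t01; rewrite mul0r addr0 -lerBlDl -dotBr -mulmxBl.
apply: le_trans (dot_mulmx_le _ _ _) _.
have [t0 t1] := andP t01.
have hl : opnorm (hessian f (x + t *: p) - hessian f x) <= LH * (t * enorm p).
  have xpx : x + t *: p - x = t *: p by rewrite addrAC subrr add0r.
  have -> : t * enorm p = enorm (x + t *: p - x) by rewrite xpx enormZ ger0_norm.
  exact: hlip (xpN t t01) Nx.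
apply: le_trans (_ : LH * (t * enorm p) * (enorm u * enorm p) <= _).
  by rewrite ler_wpM2r// mulr_ge0 ?enorm_ge0.
by rewrite le_eqVlt; apply/orP; left; apply/eqP; ring.
Qed.

Lemma taylor_le x p : (forall t : R, 0 <= t <= 1 -> N (x + t *: p)) ->
  f (x + p) <=
    f x + dot (gradient f x) p + qform (hessian f x) p / 2 + LH / 6 * enorm p ^+ 3.
Proof.
move=> xpN.
case: (fN) => df _ _ _.
have := derive_le_quadratic (fun t t01 => is_derive_line (df _ (xpN t t01)))
  (a := dot (gradient f x) p) (b := qform (hessian f x) p) (c := LH / 2 * enorm p ^+ 3).
rewrite scale0r addr0 scale1r => h.
rewrite -!addrA -lerBlDl; apply: le_trans (h _) _; last by lra.
move=> t /andP[t0 t1]; rewrite dotC (dotC _ p).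
have tpN (s : R) : 0 <= s <= 1 -> N (x + s *: (t *: p)).
  move=> /andP[s0 s1]; rewrite scalerA; apply: xpN.
  by rewrite mulr_ge0//= (le_trans _ t1)// ler_piMl.
have := @taylor_gradient x (t *: p) p tpN.
rewrite -scalemxAr dotZr enormZ ger0_norm// -/(qform _ _).
by move=> h'; apply: le_trans h' _; rewrite le_eqVlt; apply/orP; left; apply/eqP; ring.
Qed.

Lemma taylor_gradient_norm x p u : (forall t : R, 0 <= t <= 1 -> N (x + t *: p)) ->
  `|dot u (gradient f (x + p)) - dot u (gradient f x) - dot u (hessian f x *m p)| <=
    LH / 2 * enorm p ^+ 2 * enorm u.
Proof.
move=> xpN; have := taylor_gradient u xpN; have := taylor_gradient (- u) xpN.
by rewrite !dotNl enormN ler_norml => ? ?; apply/andP; split; lra.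
Qed.

(* The second difference is symmetric in u and v, whence Schwarz's theorem. *)
Lemma second_difference x u v (s : R) : 0 < s -> 0 <= LH ->
  (forall a b : R, 0 <= a <= s -> 0 <= b <= s -> N (x + (a *: u + b *: v))) ->
  `|f (x + (s *: u + s *: v)) - f (x + s *: u) - f (x + s *: v) + f x -
    s ^+ 2 * dot u (hessian f x *m v)| <=
  s ^+ 3 * (LH * (enorm u + enorm v) ^+ 3).
Proof.
move=> s0 LH0 abN; have [df _ _ _] := fN.
pose h (b t : R) := f ((x + b *: v) + t *: u).
have abN' a b : 0 <= a <= s -> 0 <= b <= s -> N ((x + b *: v) + a *: u).
  by move=> ? ?; rewrite -addrA (addrC (b *: v)); apply: abN.
(* The mean value theorem in the direction u leaves the difference of the gradients at
   [xi *: u + s *: v] and [xi *: u]. Both are compared with the gradient at x, and the terms in xi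
   cancel. *)
have [||xi] := @MVT_segment R (fun t => h s t - h 0 t)
  (fun t => dot (gradient f ((x + s *: v) + t *: u)) u -
            dot (gradient f ((x + 0 *: v) + t *: u)) u) 0 s (ltW s0).
- move=> t; rewrite in_itv/= => /andP[t0 ts].
  by apply: is_deriveB; apply: is_derive_line; apply: df; apply: abN';
    rewrite ?lexx ?ltW.
- apply: derivable_within_continuous => t; rewrite in_itv/= => ts.
  have := @is_derive_line f (x + s *: v) u t (df _ _).
  have := @is_derive_line f (x + 0 *: v) u t (df _ _).
  rewrite -/(h _).
  move=> /(_ (abN' _ _ ts _)) h0 /(_ (abN' _ _ ts _)) hs.
  apply: derivableB; apply: ex_derive; [apply: hs|apply: h0]; by rewrite lexx ltW.
rewrite in_itv/= => xi_s.
have pts (b t : R) : x + b *: v + t *: u = x + (t *: u + b *: v).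
  by rewrite -addrA (addrC (b *: v)).
have dC y : dot (gradient f y) u = dot u (gradient f y) by exact: dotC.
rewrite /h !pts !dC !scale0r !addr0 add0r subr0 => D.
set m := enorm u + enorm v.
have u_ge0 := enorm_ge0 u; have v_ge0 := enorm_ge0 v.
have [xi0 xis] := andP xi_s.
have line b : 0 <= b <= s -> enorm (xi *: u + b *: v) <= s * m /\
    (forall t : R, 0 <= t <= 1 -> N (x + t *: (xi *: u + b *: v))).
  move=> /andP[b0 bs]; split.
    rewrite mulrDr; apply: le_trans (enormD _ _) _.
    by rewrite !enormZ !ger0_norm// lerD// ler_wpM2r.
  move=> t /andP[t0 t1]; rewrite scalerDr !scalerA; apply: abN.
    by rewrite mulr_ge0//= (le_trans _ xis)// ler_piMl.
  by rewrite mulr_ge0//= (le_trans _ bs)// ler_piMl.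
have grad_diff b : 0 <= b <= s ->
    `|dot u (gradient f (x + (xi *: u + b *: v))) - dot u (gradient f x) -
      dot u (hessian f x *m (xi *: u + b *: v))| <= LH / 2 * (s * m) ^+ 2 * m.
  move=> /line[sm xN]; apply: le_trans (taylor_gradient_norm u xN) _.
  have sm_ge0 : 0 <= s * m by rewrite mulr_ge0 ?addr_ge0// ltW.
  have LH2 : 0 <= LH / 2 by rewrite divr_ge0.
  apply: ler_pM => //; last by rewrite lerDl.
    by apply: mulr_ge0 => //; exact: sqr_ge0.
  by apply: ler_wpM2l => //; rewrite ler_pXn2r ?nnegrE ?enorm_ge0.
have := grad_diff s; rewrite lexx ltW// => /(_ isT).
have := grad_diff 0; rewrite lexx ltW// => /(_ isT).
rewrite scale0r addr0 mulmxDr dotDr -!scalemxAr !dotZr.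
move: D; rewrite [X in X - (_ - _)]addrC.
set G1 := dot u (gradient f (x + (xi *: u + s *: v))).
set G2 := dot u (gradient f (x + xi *: u)).
set q := dot u (hessian f x *m v); set quu := dot u (hessian f x *m u).
move=> D h2 h1.
have -> : f (x + (s *: u + s *: v)) - f (x + s *: u) - f (x + s *: v) + f x =
    (G1 - G2) * s by rewrite -D; ring.
have -> : (G1 - G2) * s - s ^+ 2 * q = s * ((G1 - dot u (gradient f x) -
  (xi * quu + s * q)) - (G2 - dot u (gradient f x) - xi * quu)) by ring.
rewrite normrM gtr0_norm// exprS -mulrA ler_pM2l//.
apply: le_trans (ler_normB _ _) _; apply: le_trans (lerD h1 h2) _.
by rewrite le_eqVlt; apply/orP; left; apply/eqP; field.
Qed.

(** Exchanging u and v does not change the second difference, so after division by s^2 the two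
    values differ by O(s), for every small s. *)
Lemma hessian_dot_sym x u v : open N -> N x -> 0 <= LH ->
  dot u (hessian f x *m v) = dot v (hessian f x *m u).
Proof.
move=> oN Nx LH0.
have /nbhs_normP[r /= r0 rN] : nbhs x N by exact: open_nbhs_nbhs.
set m := enorm u + enorm v; set C := LH * m ^+ 3.
have u_ge0 := enorm_ge0 u; have v_ge0 := enorm_ge0 v.
have m_ge0 : 0 <= m by exact: addr_ge0.
have C_ge0 : 0 <= C by rewrite mulr_ge0 ?exprn_ge0.
have small_le s : 0 < s -> s * (m + 1) < r ->
    `|dot u (hessian f x *m v) - dot v (hessian f x *m u)| <= s * (2 * C).
  move=> s0 sr.
  have abN a b w z : 0 <= a <= s -> 0 <= b <= s -> enorm w + enorm z = m ->
      N (x + (a *: w + b *: z)).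
    move=> /andP[a0 as_] /andP[b0 bs] wz; apply: rN => /=.
    rewrite opprD addrA subrr add0r normrN.
    apply: le_lt_trans (norm_le_enorm _) _; apply: le_lt_trans (enormD _ _) _.
    rewrite !enormZ !ger0_norm//; apply: le_lt_trans sr.
    have := enorm_ge0 w; have := enorm_ge0 z => z0 w0.
    rewrite -wz mulrDr mulr1 mulrDr.
    have := ler_wpM2r w0 as_; have := ler_wpM2r z0 bs; lra.
  have := second_difference s0 LH0 (fun a b ha hb => abN a b u v ha hb erefl).
  have := second_difference s0 LH0 (fun a b ha hb => abN a b v u ha hb (addrC _ _)).
  rewrite (addrC (s *: v)) (addrC (enorm v)) -/m -/C.
  set a := dot u _; set b := dot v _; rewrite [_ - f (x + s *: v) - _]addrAC.
  set D := _ + f x; move=> h1 h2.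
  rewrite -(ler_pM2l (_ : 0 < s ^+ 2)) ?exprn_gt0//.
  rewrite -[X in X * _]gtr0_norm ?exprn_gt0// -normrM.
  have -> : s ^+ 2 * (a - b) = (D - s ^+ 2 * b) - (D - s ^+ 2 * a) by ring.
  apply: le_trans (ler_normB _ _) _; apply: le_trans (lerD h1 h2) _.
  by rewrite le_eqVlt; apply/orP; left; apply/eqP; ring.
apply/eqP; rewrite -subr_eq0 -normr_le0; apply/ler_addgt0Pl => e e0; rewrite addr0.
(* The first entry keeps the parallelogram within half the radius of the ball; the second makes s *
   (2 * C) at most e. *)
pose s := Num.min (r / (2 * (m + 1))) (e / (2 * C + 1)).
have s0 : 0 < s.
  by rewrite lt_min !divr_gt0// ?mulr_gt0 ?ltr_wpDl// mulr_ge0.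
apply: le_trans (small_le s s0 _) _.
  apply: le_lt_trans (_ : r / (2 * (m + 1)) * (m + 1) < _).
    by rewrite ler_wpM2r ?addr_ge0// ge_min lexx.
  have -> : r / (2 * (m + 1)) * (m + 1) = r / 2.
    by field; rewrite gt_eqF// ltr_wpDl.
  lra.
apply: le_trans (_ : e / (2 * C + 1) * (2 * C) <= _).
  by rewrite ler_wpM2r ?mulr_ge0// ge_min lexx orbT.
by rewrite mulrAC ler_pdivrMr ?ltr_wpDl ?mulr_ge0// ler_pM2l// lerDl.
Qed.

Lemma hessian_sym x : open N -> N x -> 0 <= LH -> (hessian f x)^T = hessian f x.
Proof.
move=> oN Nx LH0; apply/matrixP => i j.
have entry (A : 'M[R]_n) k l : dot (delta_mx k 0) (A *m delta_mx l 0) = A k l.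
  rewrite /dot (bigD1 k)//= big1 ?addr0 => [|k' kk'].
    rewrite !mxE !eqxx mul1r (bigD1 l)//= mxE !eqxx mulr1 big1 ?addr0// => m ml.
    by rewrite mxE (negbTE ml) mulr0.
  by rewrite !mxE (negbTE kk') mul0r.
by rewrite mxE -!entry hessian_dot_sym.
Qed.

End Taylor.

(** * Conjugate gradients *)

Section ConjugateGradient.
Context {R : realType} {n : nat}.
Variables (A : 'M[R]_n) (g : 'cV[R]_n) (y r p : nat -> 'cV[R]_n).
Hypothesis A_sym : A^T = A.
Let a j := enorm (r j) ^+ 2 / qform A (p j).
Let b j := enorm (r j.+1) ^+ 2 / enorm (r j) ^+ 2.
Hypotheses (y0 : y 0 = 0) (r0 : r 0 = g) (p0 : p 0 = - g).
Hypothesis yS : forall j, y j.+1 = y j + a j *: p j.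
Hypothesis rS : forall j, r j.+1 = r j + a j *: (A *m p j).
Hypothesis pS : forall j, p j.+1 = - r j.+1 + b j *: p j.

(** The recurrences run through all indices, with division by zero giving zero. Their identities are
    claimed only while the divisors of all earlier steps are nonzero; positivity of the curvatures
    also yields descent. *)
Definition cg_regular j := forall i, (i < j)%N -> r i != 0 /\ 0 < qform A (p i).

Lemma cg_regular_le i j : (i <= j)%N -> cg_regular j -> cg_regular i.
Proof. by move=> ij reg k ki; apply: reg; exact: leq_trans ij. Qed.

Lemma cg_residual j : r j = g + A *m y j.
Proof.
elim: j => [|j IH]; first by rewrite y0 r0 mulmx0 addr0.
by rewrite rS yS mulmxDr IH scalemxAr addrA.
Qed.

(** The recurrence for p read backwards, by which facts about the directions pass to the
    residuals. *)
Lemma cg_p_r j : exists2 c, r j = - p j + c *: (if j is i.+1 then p i else 0) &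
  j = 0%N -> c = 0.
Proof.
case: j => [|j]; first by exists 0; rewrite ?r0 ?p0 ?scale0r ?opprK ?addr0.
by exists (b j); rewrite // pS opprD opprK subrK.
Qed.

Lemma cg_dot_r j z : (forall i, (i <= j)%N -> dot z (p i) = 0) -> dot z (r j) = 0.
Proof.
have [c -> _] := cg_p_r j; move=> zp; rewrite dotDr dotNr dotZr zp// oppr0 add0r.
by case: j zp => [|j] zp; rewrite ?dot0r ?mulr0// zp ?mulr0.
Qed.

(** The four claims feed one another and need a single induction: conjugacy gives orthogonality of
    the new residual to the directions, hence to the residuals, and since A p^i is a multiple of
    r^{i+1} - r^i, this gives back conjugacy. *)
Lemma cg_orthogonal j : cg_regular j ->
  [/\ forall i, (i < j)%N -> dot (r j) (r i) = 0,
      forall i, (i < j)%N -> dot (r j) (p i) = 0,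
      forall i, (i < j)%N -> dot (p j) (A *m p i) = 0 &
      dot (r j) (p j) = - enorm (r j) ^+ 2].
Proof.
elim: j => [|j IH] reg; first by split=> //; rewrite p0 r0 dotNr sqr_enorm.
have [rr rp pAp rjpj] := IH (cg_regular_le (leqnSn j) reg).
have [rj0 pj_gt0] := reg j (ltnSn j).
have a_neq0 i : (i <= j)%N -> a i != 0.
  by move=> ij; have [ri0 pi] := reg i ij;
    rewrite mulf_neq0 ?invr_eq0 ?gt_eqF// exprn_gt0// enorm_gt0.
have r_p i : (i <= j)%N -> dot (r j.+1) (p i) = 0.
  rewrite leq_eqVlt => /predU1P[->|ij]; rewrite rS dotDl dotZl.
    rewrite rjpj dotC -/(qform A _) /a divfK ?gt_eqF// addNr.
    by [].
  by rewrite rp// dotC -dot_sym// dotC pAp// mulr0 addr0.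
have r_r i : (i <= j)%N -> dot (r j.+1) (r i) = 0.
  by move=> ij; apply: cg_dot_r => k ki; apply: r_p; exact: leq_trans ij.
have Ap i : (i <= j)%N -> A *m p i = (a i)^-1 *: (r i.+1 - r i).
  by move=> ij; rewrite rS addrAC subrr add0r scalerA mulVf ?scale1r ?a_neq0.
split.
- by move=> i; rewrite ltnS; exact: r_r.
- by move=> i; rewrite ltnS; exact: r_p.
- move=> i; rewrite ltnS leq_eqVlt => /predU1P[->|ij]; rewrite pS dotDl dotZl dotNl.
    have -> : dot (r j.+1) (A *m p j) = (a j)^-1 * enorm (r j.+1) ^+ 2.
      by rewrite Ap// dotZr dotBr (r_r j (leqnn j)) subr0 sqr_enorm.
    rewrite -/(qform A (p j)) /b /a; field.
    by rewrite enorm_eq0 rj0 gt_eqF.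
  by rewrite pAp// mulr0 addr0 Ap ?(ltnW ij)// dotZr dotBr !r_r ?(ltnW ij)// subr0 mulr0 oppr0.
- by rewrite pS dotDr dotNr dotZr r_p// mulr0 addr0 sqr_enorm.
Qed.

Lemma cg_r_orthogonal i j : cg_regular (maxn i j) -> i != j -> dot (r i) (r j) = 0.
Proof.
wlog ij : i j / (i < j)%N => [H reg|reg _].
  rewrite neq_ltn => /orP[|] ij; first by apply: H; rewrite // ltn_eqF.
  by rewrite dotC; apply: H; rewrite 1?maxnC// ltn_eqF.
by rewrite dotC; have [-> //] := cg_orthogonal (cg_regular_le (leq_maxr i j) reg).
Qed.

Lemma cg_r_y i j : cg_regular j -> (i <= j)%N -> dot (r j) (y i) = 0.
Proof.
move=> reg; elim: i => [|i IH] ij; first by rewrite y0 dot0r.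
have [_ rp _ _] := cg_orthogonal reg.
by rewrite yS dotDr dotZr rp// mulr0 addr0 IH// ltnW.
Qed.

(** Otherwise n + 1 nonzero orthogonal residuals would be the rows of a matrix with n columns whose
    Gram matrix is invertible. *)
Lemma cg_regular_dim : cg_regular n.+1 -> False.
Proof.
move=> reg.
pose M : 'M[R]_(n.+1, n) := \matrix_(i, j) r i j 0.
have MM : M *m M^T = diag_mx (\row_i enorm (r i) ^+ 2).
  apply/matrixP => i j; rewrite !mxE.
  transitivity (dot (r i) (r j)).
    by apply: eq_bigr => k _; rewrite !mxE.
  have [->|ij] := eqVneq i j; first by rewrite mulr1n sqr_enorm.
  rewrite mulr0n cg_r_orthogonal//; apply: cg_regular_le reg.
  by rewrite geq_max (ltnW (ltn_ord i)) (ltnW (ltn_ord j)).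
have : \rank (M *m M^T) = n.+1.
  rewrite MM; apply/mxrank_unit; rewrite unitmxE det_diag unitfE.
  apply/prodf_neq0 => i _; rewrite mxE sqrf_eq0 enorm_eq0.
  by case: (reg i (ltn_ord i)).
move=> rk; have := mxrankM_maxl M M^T; rewrite rk => h.
by have := leq_trans h (rank_leq_col M); rewrite ltnn.
Qed.

(** The quadratic q associated with the iteration; by [cg_residual] its gradient at [y j] is
    [r j]. *)
Definition cg_value z := qform A z / 2 + dot g z.

Lemma cg_value_expand z w : cg_value z =
  cg_value w + dot (g + A *m w) (z - w) + qform A (z - w) / 2.
Proof.
rewrite /cg_value /qform mulmxBr !dotBr !dotBl !dotDl !(dotC (A *m w)).
by rewrite [dot z (A *m w)]dotC (dot_sym _ _ A_sym); field.
Qed.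

Lemma cg_value_step j : cg_regular j.+1 ->
  cg_value (y j.+1) = cg_value (y j) - enorm (r j) ^+ 4 / qform A (p j) / 2.
Proof.
move=> reg; have [_ pj_gt0] := reg j (ltnSn j).
have [_ _ _ rjpj] := cg_orthogonal (cg_regular_le (leqnSn j) reg).
have yd : y j.+1 - y j = a j *: p j by rewrite yS addrAC subrr add0r.
rewrite (cg_value_expand (y j.+1) (y j)) -cg_residual yd dotZr rjpj qformZ /a.
by field; rewrite gt_eqF.
Qed.

(** By conjugacy, r^T A r is the sum of p^T A p and a nonnegative multiple of the previous
    curvature. A bound of p^T A p by the norm of p would be too weak, since the decrease must be
    measured by r. *)
Lemma cg_p_curvature_le j : cg_regular j -> qform A (p j) <= qform A (r j).
Proof.
move=> reg; have [_ _ pAp _] := cg_orthogonal reg.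
have [c -> c0] := cg_p_r j.
case: j reg pAp c0 => [|j] reg pAp c0.
  by rewrite c0// scale0r addr0 /qform mulmxN dotNl dotNr opprK.
rewrite /= /qform mulmxDr mulmxN -scalemxAr dotDl !dotDr !dotZl !dotNl !dotNr !dotZr.
rewrite (pAp j)// [dot (p j) (A *m p j.+1)]dotC (dot_sym _ _ A_sym) (pAp j)//.
have [_ pj] := reg j (ltnSn j); move: pj; rewrite /qform => pj.
rewrite !(oppr0, mulr0, opprK, subr0, addr0, add0r) lerDl mulrA -expr2.
by rewrite mulr_ge0 ?sqr_ge0// ltW.
Qed.

Section Rate.
Variables (e L : R).
Hypotheses (e_gt0 : 0 < e) (A_le : forall v, qform A v <= L * enorm v ^+ 2).

Lemma cg_L_gt0 j : cg_regular j.+1 -> 0 < L.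
Proof.
move=> reg; have [rj0 pj_gt0] := reg j (ltnSn j).
have rj_gt0 : 0 < enorm (r j) ^+ 2 by rewrite exprn_gt0 ?enorm_gt0.
rewrite -(pmulr_lgt0 _ rj_gt0) (lt_le_trans pj_gt0)//.
exact: le_trans (cg_p_curvature_le (cg_regular_le (leqnSn j) reg)) (A_le (r j)).
Qed.

Lemma cg_value_decrease j : cg_regular j.+1 ->
  enorm (r j) ^+ 2 / (2 * L) <= cg_value (y j) - cg_value (y j.+1).
Proof.
move=> reg; rewrite cg_value_step// opprB addrC subrK.
have [rj0 pj_gt0] := reg j (ltnSn j).
have rj_gt0 : 0 < enorm (r j) ^+ 2 by rewrite exprn_gt0 ?enorm_gt0.
have pL := le_trans (cg_p_curvature_le (cg_regular_le (leqnSn j) reg)) (A_le (r j)).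
have L_gt0 := cg_L_gt0 reg.
have -> : enorm (r j) ^+ 4 / qform A (p j) / 2 =
    enorm (r j) ^+ 2 / 2 * (enorm (r j) ^+ 2 / qform A (p j)) by field; rewrite gt_eqF.
have -> : enorm (r j) ^+ 2 / (2 * L) = enorm (r j) ^+ 2 / 2 * L^-1.
  by field; rewrite gt_eqF.
by rewrite ler_pM2l ?divr_gt0// ler_pdivlMr// [leLHS]mulrC ler_pdivrMr// [leRHS]mulrC.
Qed.

(** * Linear rate from an estimate sequence *)

Section EstimateSequence.
Variables (th : R) (j : nat).
Hypotheses (reg : cg_regular j.+1) (th_ge0 : 0 <= th) (th_le1 : th <= 1).
Hypothesis th_L : th ^+ 2 * L <= e.
Let z := y j.+1.
Hypothesis strong : forall i, (i < j)%N -> e * enorm (z - y i) ^+ 2 <= qform A (z - y i).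

(** The minimizer of the k-th estimate function: each step mixes, with weights 1 - th and th, the
    previous function and the e-strongly convex model of q at [y i]. *)
Fixpoint cg_center k : 'cV[R]_n :=
  if k is i.+1 then (1 - th) *: cg_center i + th *: y i - (th / e) *: r i else 0.

(** In Nesterov's method the query point is chosen so as to control the pairing of gradient and
    center. Here orthogonality makes that pairing vanish at the iterates of CG themselves. *)
Lemma cg_center_r k m : (k <= m <= j.+1)%N -> dot (r m) (cg_center k) = 0.
Proof.
elim: k => [|k IH] /andP[km mj] /=; first by rewrite dot0r.
have regm := cg_regular_le mj reg.
have km' := ltnW km.
rewrite dotBr dotDr !dotZr IH ?km'// cg_r_y//.
by have [-> // _ _ _] := cg_orthogonal regm; ring.
Qed.

Let E := e / 2 * enorm z ^+ 2 - cg_value z.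

Let enorm_mix (u v w : 'cV[R]_n) : dot u v = 0 ->
  e / 2 * enorm (w - (1 - th) *: v + (th / e) *: u) ^+ 2 =
    (1 - th) * (e / 2 * enorm (w - v) ^+ 2) +
    th * (dot u w + e / 2 * enorm w ^+ 2) -
    th * (1 - th) * (e / 2) * enorm v ^+ 2 + th ^+ 2 / (2 * e) * enorm u ^+ 2.
Proof.
move=> uv; rewrite !sqr_enorm !(dotDl, dotDr, dotBl, dotBr, dotNl, dotNr, dotZl, dotZr).
by rewrite (dotC v w) (dotC w u) (dotC v u) uv; field; rewrite gt_eqF.
Qed.

(* Nesterov's estimate sequence evaluated at the single point z: strong
   convexity is only available between z and the iterates y i. *)
Lemma cg_estimate k : (k <= j)%N ->
  cg_value (y k) + e / 2 * enorm (z - cg_center k) ^+ 2 <= cg_value z + (1 - th) ^+ k * E.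
Proof.
elim: k => [|k IH] kj.
  rewrite y0 /= subr0 expr0 mul1r /E /cg_value /qform mulmx0 !dot0r; lra.
have {}IH := IH (ltnW kj).
have regk : cg_regular k.+1 by apply: cg_regular_le reg; exact: leq_trans kj _.
have dec := cg_value_decrease regk.
have str := strong kj.
have := cg_value_expand z (y k); rewrite -cg_residual => zE.
have rV : dot (r k) (cg_center k - y k) = 0.
  rewrite dotBr cg_center_r ?leqnn ?(leq_trans _ (leqnSn j)) ?(ltnW kj)//.
  by rewrite cg_r_y ?subr0//; exact: cg_regular_le regk.
pose V := cg_center k - y k; pose w := z - y k.
have zc : z - cg_center k = w - V by rewrite /w /V opprB addrA subrK.
have zc1 : z - cg_center k.+1 = w - (1 - th) *: V + (th / e) *: r k.
  rewrite /= /w /V scalerBr !scalerBl !scale1r !opprD !opprK !addrA.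
  by apply/matrixP => i i'; rewrite !mxE; ring.
have id : e / 2 * enorm (z - cg_center k.+1) ^+ 2 =
    (1 - th) * (e / 2 * enorm (z - cg_center k) ^+ 2) +
    th * (dot (r k) w + e / 2 * enorm w ^+ 2) -
    th * (1 - th) * (e / 2) * enorm V ^+ 2 + th ^+ 2 / (2 * e) * enorm (r k) ^+ 2.
  by rewrite zc zc1; exact: enorm_mix.
(* The displacement of the center along r^k costs the left side; the decrease of q in the k-th step
   pays for it because th^2 L <= e. *)
have thL : th ^+ 2 / (2 * e) * enorm (r k) ^+ 2 <= enorm (r k) ^+ 2 / (2 * L).
  have L_gt0 := cg_L_gt0 reg.
  rewrite [leRHS]mulrC ler_wpM2r ?sqr_ge0// ler_pdivrMr ?mulr_gt0//.
  rewrite [leRHS]mulrC ler_pdivlMr ?mulr_gt0//; have := th_L; lra.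
have V_ge0 : 0 <= th * (1 - th) * (e / 2) * enorm V ^+ 2.
  apply: mulr_ge0; last exact: sqr_ge0.
  by apply: mulr_ge0; [rewrite mulr_ge0 ?subr_ge0|rewrite divr_ge0 ?ltW].
have step1 : cg_value (y k) + (dot (r k) w + e / 2 * enorm w ^+ 2) <= cg_value z.
  by rewrite zE -/w; move: str; rewrite -/w; lra.
have := ler_wpM2l th_ge0 step1.
have th1 : 0 <= 1 - th by rewrite subr_ge0.
have := ler_wpM2l th1 IH; rewrite id (exprS (1 - th)); lra.
Qed.

Lemma cg_value_le0 k : (k <= j.+1)%N -> cg_value (y k) <= 0.
Proof.
elim: k => [|k IH] kj; first by rewrite y0 /cg_value /qform mulmx0 !dot0r mul0r addr0.
apply: le_trans (IH (ltnW kj)).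
have regk : cg_regular k.+1 by exact: cg_regular_le reg.
rewrite -subr_ge0; apply: le_trans (cg_value_decrease regk).
by rewrite divr_ge0 ?sqr_ge0// mulr_ge0// ltW// (cg_L_gt0 reg).
Qed.

(** The step from y^j to z bounds the squared residual by 2 L (q(y^j) - q(z)), to which the estimate
    applies. Strong convexity for i = 0, where y^0 = 0, together with q(z) <= 0, bounds z by 2 |g| /
    e and hence E by 2 |g|^2 / e. *)
Lemma cg_slow_residual : (0 < j)%N ->
  enorm (r j) ^+ 2 <= 4 * (L / e) * (1 - th) ^+ j * enorm g ^+ 2.
Proof.
move=> j0; have L_gt0 := cg_L_gt0 reg.
have str := strong j0; rewrite y0 subr0 in str.
have z_le0 := cg_value_le0 (leqnn _); rewrite -/z in z_le0.
have gz : - dot g z <= enorm g * enorm z by rewrite -dotNl -(enormN g) cauchy_schwarz.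
have z_le : enorm z <= 2 * enorm g / e.
  have [->|z0] := eqVneq z 0.
    by rewrite enorm0 divr_ge0 ?mulr_ge0 ?enorm_ge0// ltW.
  have z_gt0 : 0 < enorm z by rewrite enorm_gt0.
  rewrite ler_pdivlMr// -(ler_pM2r z_gt0).
  by move: z_le0; rewrite /cg_value; lra.
have E_le : E <= 2 * enorm g ^+ 2 / e.
  have := ler_wpM2l (enorm_ge0 g) z_le; rewrite /E /cg_value; lra.
have th1 : 0 <= (1 - th) ^+ j by rewrite exprn_ge0// subr_ge0.
have est := cg_estimate (leqnn j); have dec := cg_value_decrease reg.
have c_ge0 : 0 <= e / 2 * enorm (z - cg_center j) ^+ 2.
  by rewrite mulr_ge0 ?sqr_ge0// divr_ge0// ltW.
have : enorm (r j) ^+ 2 / (2 * L) <= (1 - th) ^+ j * (2 * enorm g ^+ 2 / e).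
  have := ler_wpM2l th1 E_le; move: dec; rewrite -/z; lra.
rewrite ler_pdivrMr ?mulr_gt0// => h; apply: le_trans h _.
by rewrite le_eqVlt; apply/orP; left; apply/eqP; ring.
Qed.

End EstimateSequence.
End Rate.
End ConjugateGradient.

(** * Capped conjugate gradients *)

Section Constants.
Context {R : realType}.
Variables (eps zeta : R).
Hypotheses (eps_gt0 : 0 < eps) (zeta01 : 0 < zeta < 1).
Implicit Types M : R.

Lemma kappa_ge2 M : 0 <= M -> 2 <= kappa eps M.
Proof. by move=> M0; rewrite /kappa ler_pdivlMr// lerDr. Qed.

Lemma kappa_gt0 M : 0 <= M -> 0 < kappa eps M.
Proof. by move=> /kappa_ge2; apply: lt_le_trans. Qed.

Lemma kappa_le M M' : M <= M' -> kappa eps M <= kappa eps M'.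
Proof. by move=> MM; rewrite /kappa ler_pM2r ?invr_gt0// lerD2r. Qed.

Lemma zeta_hat_gt0 M : 0 <= M -> 0 < zeta_hat eps zeta M.
Proof. by move=> M0; case/andP: zeta01 => ? _; rewrite divr_gt0// mulr_gt0 ?kappa_gt0. Qed.

Lemma zeta_hat_lt1 M : 0 <= M -> zeta_hat eps zeta M < 1.
Proof.
move=> M0; have k2 := kappa_ge2 M0; case/andP: zeta01 => z0 z1.
by rewrite /zeta_hat ltr_pdivrMr ?mul1r; lra.
Qed.

Lemma zeta_hat_le M M' : 0 <= M -> M <= M' -> zeta_hat eps zeta M' <= zeta_hat eps zeta M.
Proof.
move=> M0 MM; case/andP: zeta01 => z0 _; have M'0 := le_trans M0 MM.
have k := kappa_gt0 M0; have k' := kappa_gt0 M'0.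
rewrite /zeta_hat ler_pM2l// lef_pV2 ?posrE ?(mulr_gt0 _ k) ?(mulr_gt0 _ k')//.
by rewrite ler_pM2l// kappa_le.
Qed.

(** Identifies tau with the contraction factor 1 - th for th = 1 / (sqrt kappa + 1), which satisfies
    th^2 <= 1 / kappa. *)
Lemma tauE M : tau eps M = 1 - (Num.sqrt (kappa eps M) + 1)^-1.
Proof.
rewrite /tau; field; rewrite gt_eqF// ltr_wpDl ?sqrtr_ge0//.
Qed.

Lemma tau_gt0 M : 0 <= M -> 0 < tau eps M.
Proof. by move=> /kappa_gt0 ?; rewrite divr_gt0 ?sqrtr_gt0// ltr_wpDl ?sqrtr_ge0. Qed.

Lemma tau_lt1 M : tau eps M < 1.
Proof. by rewrite tauE ltrBlDr ltrDl invr_gt0 ltr_wpDl ?sqrtr_ge0. Qed.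

Lemma tau_le M M' : M <= M' -> tau eps M <= tau eps M'.
Proof.
move=> MM; rewrite !tauE lerD2l lerN2 lef_pV2 ?posrE ?ltr_wpDl ?sqrtr_ge0//.
by rewrite lerD2r ler_wsqrtr// kappa_le.
Qed.

Lemma sqrt_tau_lt1 M : Num.sqrt (tau eps M) < 1.
Proof. by rewrite -[ltRHS]sqrtr1 ltr_sqrt// tau_lt1. Qed.

Lemma bigT_gt0 M : 0 <= M -> 0 < bigT eps M.
Proof.
move=> /kappa_gt0 k; apply: divr_gt0; first by apply: mulr_gt0 => //; exact: exprn_gt0.
by apply: exprn_gt0; rewrite subr_gt0 sqrt_tau_lt1.
Qed.

Lemma bigT_le M M' : 0 <= M -> M <= M' -> bigT eps M <= bigT eps M'.
Proof.
move=> M0 MM; have M'0 := le_trans M0 MM.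
have k := kappa_gt0 M0; have k' := kappa_gt0 M'0.
have s M1 : 0 < 1 - Num.sqrt (tau eps M1) by rewrite subr_gt0 sqrt_tau_lt1.
apply: ler_pM; rewrite ?invr_ge0 ?sqr_ge0//.
- by apply: mulr_ge0 => //; exact/exprn_ge0/ltW.
- by rewrite ler_pM2l// ler_pXn2r ?nnegrE ?kappa_le// ltW.
- rewrite lef_pV2 ?posrE ?exprn_gt0// ler_pXn2r ?nnegrE ?(ltW (s _))//.
  by rewrite lerD2l lerN2 ler_wsqrtr// tau_le.
Qed.

Lemma bigT_ge M : 0 <= M -> 4 * kappa eps M <= bigT eps M.
Proof.
move=> M0; have k2 := kappa_ge2 M0; have k := kappa_gt0 M0.
have s0 : 0 < 1 - Num.sqrt (tau eps M) by rewrite subr_gt0 sqrt_tau_lt1.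
have s1 : 1 - Num.sqrt (tau eps M) <= 1 by rewrite lerBlDr lerDl sqrtr_ge0.
rewrite /bigT ler_pdivlMr ?exprn_gt0// -mulrA ler_pM2l//.
apply: le_trans (_ : kappa eps M * 1 <= _).
  by rewrite ler_pM2l// exprn_ile1// ltW.
rewrite exprS ler_pM2l// exprn_ege1//; lra.
Qed.

Lemma sqr_decay M j : 0 <= M -> decay eps M j ^+ 2 = bigT eps M * tau eps M ^+ j.
Proof.
move=> M0; rewrite /decay exprMn sqr_sqrtr ?ltW ?bigT_gt0//; congr (_ * _).
have t0 := ltW (tau_gt0 M0).
by rewrite -[LHS]powR_mulrn ?powR_ge0// -powRrM divfK// powR_mulrn.
Qed.

Lemma decay_ge0 M j : 0 <= decay eps M j.
Proof. by rewrite mulr_ge0 ?sqrtr_ge0 ?powR_ge0. Qed.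

(** M grows during a call but stays below U. As [decay] increases and [zeta_hat] decreases with M,
    the index J computed from U serves for every running M. *)
Lemma decay_le M M' j : 0 <= M -> M <= M' -> decay eps M j <= decay eps M' j.
Proof.
move=> M0 MM; have M'0 := le_trans M0 MM.
rewrite -(ler_pXn2r (_ : 0 < 2)%N) ?nnegrE ?decay_ge0// !sqr_decay//.
apply: ler_pM; rewrite ?bigT_le//; first exact/ltW/bigT_gt0.
  exact/exprn_ge0/ltW/tau_gt0.
have := tau_gt0 M0; have := tau_gt0 M'0 => t' t.
by apply: lerXn2r; rewrite ?nnegrE ?tau_le// ltW.
Qed.

Variables (cmu M r0 : R).
Hypotheses (cmu_gt0 : 0 < cmu) (M_ge0 : 0 <= M) (r0_gt0 : 0 < r0).

Lemma J_ok_exists : exists J, J_ok eps zeta cmu M r0 J.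
Proof.
pose c := Num.min (zeta_hat eps zeta M * r0) cmu.
have c_gt0 : 0 < c by rewrite lt_min cmu_gt0 andbT mulr_gt0 ?zeta_hat_gt0.
have T_gt0 : 0 < Num.sqrt (bigT eps M) by rewrite sqrtr_gt0 bigT_gt0.
have t0 := tau_gt0 M_ge0.
pose q := Num.sqrt (tau eps M).
have q1 : `|q| < 1 by rewrite ger0_norm ?sqrtr_ge0// sqrt_tau_lt1.
have e0 : 0 < c / (Num.sqrt (bigT eps M) * r0) by rewrite divr_gt0// mulr_gt0.
have /cvgr0Pnorm_lt/(_ _ e0)[J _ /(_ J (leqnn J))/= small] := cvg_expr q1.
exists J; rewrite /J_ok -/c.
have -> : decay eps M J = Num.sqrt (bigT eps M) * q ^+ J.
  rewrite /decay (mulrC J%:R) powRrM powR12_sqrt ?ltW//.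
  by rewrite powR_mulrn ?sqrtr_ge0.
rewrite mulrAC mulrC -ler_pdivlMr ?mulr_gt0//.
exact: le_trans (ler_norm _) (ltW small).
Qed.

(** Ensures that the tests of index J are those of the loop and not the initial curvature test. *)
Lemma J_okN0 : ~ J_ok eps zeta cmu M r0 0.
Proof.
rewrite /J_ok le_min => /andP[+ _]; rewrite ler_pM2r//; apply/negP; rewrite -ltNge.
apply: lt_le_trans (zeta_hat_lt1 M_ge0) _.
rewrite -(ler_pXn2r (_ : 0 < 2)%N) ?nnegrE ?decay_ge0// sqr_decay// expr1n expr0 mulr1.
by apply: le_trans (bigT_ge M_ge0); have := kappa_ge2 M_ge0; lra.
Qed.

Lemma J_indexP : J_ok eps zeta cmu M r0 (J_index eps zeta cmu M r0).
Proof.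
rewrite /J_index.
have [J J_ok_J] := J_ok_exists.
have exJ : exists J', `[< J_ok eps zeta cmu M r0 J' >] by exists J; apply/asboolP.
suff : [set J | J_ok eps zeta cmu M r0 J /\
    forall J', J_ok eps zeta cmu M r0 J' -> (J <= J')%N] (ex_minn exJ).
  by move=> exP; have [] := xgetPex 0%N (ex_intro _ _ exP).
case: ex_minnP => m /asboolP Pm mmin; split=> // J' PJ'.
by apply: mmin; apply/asboolP.
Qed.

Lemma J_index_gt0 : (0 < J_index eps zeta cmu M r0)%N.
Proof. by rewrite lt0n; apply/eqP => J0; apply: J_okN0; rewrite -J0; exact: J_indexP. Qed.

End Constants.

(** * Termination, cost and output of a call of CCG *)

Section CappedCG.
Context {R : realType} {n : nat}.
Variables (H : 'M[R]_n) (g : 'cV[R]_n) (eps zeta cmu M0 U : R).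
Hypotheses (H_sym : H^T = H) (g_neq0 : g != 0) (eps_gt0 : 0 < eps).
Hypotheses (zeta01 : 0 < zeta < 1) (cmu_gt0 : 0 < cmu) (M0_ge0 : 0 <= M0).
Hypothesis H_le : forall v, qform H v <= U * enorm v ^+ 2.
Hypothesis M_le : ccg_M_le H g eps zeta cmu M0 U.

Let A := Hbar H eps.
Let st := cg H g eps M0.
Let y j := cg_y (st j).
Let r j := cg_r (st j).
Let p j := cg_p (st j).
Let pending := ccg_pending H g eps zeta cmu M0.
Let test := ccg_test H g eps zeta cmu M0.
Let regular := cg_regular A r p.

Lemma Hbar_sym : A^T = A.
Proof. by rewrite /A /Hbar linearD /= tr_scalar_mx H_sym. Qed.

Lemma qform_Hbar v : qform A v = qform H v + 2 * eps * enorm v ^+ 2.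
Proof. by rewrite /qform /A /Hbar mulmxDl mul_scalar_mx dotDr dotZr sqr_enorm. Qed.

Let A_sym := Hbar_sym.

Let yS j : y j.+1 = y j + (enorm (r j) ^+ 2 / qform A (p j)) *: p j.
Proof. by []. Qed.

Let rS j : r j.+1 = r j + (enorm (r j) ^+ 2 / qform A (p j)) *: (A *m p j).
Proof. by []. Qed.

Let pS j : p j.+1 = - r j.+1 + (enorm (r j.+1) ^+ 2 / enorm (r j) ^+ 2) *: p j.
Proof. by []. Qed.

Let y0 : y 0 = 0. Proof. by []. Qed.
Let r0 : r 0 = g. Proof. by []. Qed.
Let p0 : p 0 = - g. Proof. by []. Qed.

Lemma update_M_ge M zs : M <= update_M H M zs.
Proof.
rewrite /update_M; case E: [seq z <- zs | _] => [|z zs'] //.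
have : z \in [seq z <- zs | M * enorm z < enorm (H *m z)] by rewrite E mem_head.
rewrite mem_filter => /andP[Mz _].
have [z0|z0] := eqVneq z 0; first by move: Mz; rewrite z0 mulmx0 enorm0 mulr0 ltxx.
by rewrite ler_pdivlMr ?enorm_gt0// ltW.
Qed.

Lemma cg_M_ge j : M0 <= cg_M (st j).
Proof.
elim: j => [|j IH]; last exact: le_trans IH (update_M_ge _ _).
by rewrite /st /cg /= ; case: ifP => // _; exact: update_M_ge.
Qed.

Let cg_M_ge0 j : 0 <= cg_M (st j) := le_trans M0_ge0 (cg_M_ge j).

Let small j :=
  (enorm (r j) <= zeta_hat eps zeta (cg_M (st j)) * enorm g) && (`|r j| <= cmu).

Lemma ccg_test0_fail : (forall res, ~ test 0 res) -> ~~ low_curv H eps (p 0).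
Proof. by move=> t; apply/negP => lp; apply: (t (CCGResult (p 0) NC 1)). Qed.

Let testE j res : test j.+1 res = if low_curv H eps (y j.+1)
    then res = CCGResult (y j.+1) NC j.+2
  else if small j.+1 then res = CCGResult (y j.+1) SOL j.+2
  else if low_curv H eps (p j.+1) then res = CCGResult (p j.+1) NC j.+2
  else decay eps (cg_M (st j.+1)) j.+1 * enorm g < enorm (r j.+1) /\
       exists i prods, let d := y j.+2 - y i in
         [/\ (i < j.+1)%N, low_curv H eps d, (j.+2 <= prods <= j.+2 + j.+1)%N &
             res = CCGResult d NC prods].
Proof. by []. Qed.

(** A slow residual at an index that does not return means that no i was found in test (4). The last
    clause is thus the source of the strong convexity along y^{j+1} - y^i. *)
Lemma ccg_test_fail j : (0 < j)%N -> (forall res, ~ test j res) ->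
  [/\ ~~ low_curv H eps (y j), ~~ small j, ~~ low_curv H eps (p j) &
      decay eps (cg_M (st j)) j * enorm g < enorm (r j) ->
      forall i, (i < j)%N -> ~~ low_curv H eps (y j.+1 - y i)].
Proof.
case: j => // j _ t.
have ly : ~~ low_curv H eps (y j.+1).
  by apply/negP => lc; apply: (t (CCGResult (y j.+1) NC j.+2)); rewrite testE lc.
have sm : ~~ small j.+1.
  apply/negP => sm; apply: (t (CCGResult (y j.+1) SOL j.+2)).
  by rewrite testE (negbTE ly) sm.
have lp : ~~ low_curv H eps (p j.+1).
  apply/negP => lc; apply: (t (CCGResult (p j.+1) NC j.+2)).
  by rewrite testE (negbTE ly) (negbTE sm) lc.
split=> // slow i ij; apply/negP => lc.
apply: (t (CCGResult (y j.+2 - y i) NC j.+2)).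
rewrite testE (negbTE ly) (negbTE sm) (negbTE lp); split=> //.
by exists i, j.+2; split; rewrite // leqnn leq_addr.
Qed.

Lemma low_curvN v : low_curv H eps v = false -> eps * enorm v ^+ 2 <= qform A v.
Proof. by rewrite /low_curv -/A => /negbT; rewrite -leNgt. Qed.

Lemma pending_le i j : (i <= j)%N -> pending j -> pending i.
Proof. by move=> ij pj k ki; apply: pj; exact: leq_trans ij. Qed.

(** A zero residual would have passed test (2). The curvature tests make p^T A p at least eps |p|^2,
    and p is nonzero because r^T p = - |r|^2. *)
Lemma pending_regular j : pending j -> regular j.
Proof.
elim: j => [|j IH] pj; first by [].
have regj := IH (pending_le (leqnSn j) pj).
have tj := pj j (ltnSn j).
have [_ _ _ rp] := cg_orthogonal A_sym r0 p0 rS pS regj.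
suff [rj0 lp] : r j != 0 /\ ~~ low_curv H eps (p j).
  move=> i; rewrite ltnS leq_eqVlt => /predU1P[->|]; last exact: regj.
  split=> //; apply: lt_le_trans (low_curvN (negbTE lp)).
  rewrite mulr_gt0// exprn_gt0// enorm_gt0; apply: contra_neq rj0 => pj0.
  by apply/eqP; rewrite -enorm_eq0 -sqrf_eq0 -oppr_eq0 -rp pj0 dot0r.
case: j tj {IH pj regj rp} => [|j] tj; first by split; [|exact: ccg_test0_fail].
have [_ sm lp _] := ccg_test_fail (ltn0Sn j) tj; split=> //.
apply: contraNneq sm => rj0; rewrite /small rj0 enorm0 normr0 (ltW cmu_gt0) andbT.
by rewrite mulr_ge0 ?enorm_ge0// ltW// zeta_hat_gt0.
Qed.

Lemma pending_dim : ~ pending n.+1.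
Proof. by move=> /pending_regular; exact: (cg_regular_dim A_sym r0 p0 rS pS). Qed.

Let J := J_index eps zeta cmu U (enorm g).

Let U_ge0 : 0 <= U := le_trans M0_ge0 (proj1 M_le).

Let g_gt0 : 0 < enorm g. Proof. by rewrite enorm_gt0. Qed.

Lemma J_gt0 : (0 < J)%N. Proof. exact: J_index_gt0. Qed.

(* The rate is obtained with the bound U on H and not with the running M: an
   update of M may leave the residual violating |H r| <= M |r|, as only the
   first violator counts. *)
Lemma pending_J : ~ pending J.+1.
Proof.
move=> pJ; have reg := pending_regular pJ.
have J_gt0 := J_gt0.
have [_ /negP sm _ slow] := ccg_test_fail J_gt0 (pJ J (ltnSn J)).
apply: sm.
have MJ_le : cg_M (st J) <= U by apply: (proj2 M_le); exact: pending_le pJ.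
have MJ0 := cg_M_ge0 J.
have : J_ok eps zeta cmu U (enorm g) J by exact: J_indexP.
rewrite /J_ok le_min => /andP[dz dc].
suff rd : enorm (r J) <= decay eps U J * enorm g.
  rewrite /small (le_trans (norm_le_enorm _) (le_trans rd dc)) andbT.
  apply: le_trans (le_trans rd dz) _.
  by rewrite ler_pM2r// zeta_hat_le.
(* If the residual is not slow, the bound with the running M implies the one with U. If it is slow,
   the failed search of test (4) provides the hypothesis of the estimate sequence. *)
have [{slow}fast|slowJ] := leP (enorm (r J)) (decay eps (cg_M (st J)) J * enorm g).
  by apply: le_trans fast _; rewrite ler_pM2r// decay_le.
have {slow}strong i (iJ : (i < J)%N) := low_curvN (negbTE (slow slowJ i iJ)).
have A_le v : qform A v <= (U + 2 * eps) * enorm v ^+ 2.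
  by rewrite qform_Hbar [leRHS]mulrDl lerD2r.
pose th := (Num.sqrt (kappa eps U) + 1)^-1.
have s_ge0 := sqrtr_ge0 (kappa eps U).
have s1_gt0 : 0 < Num.sqrt (kappa eps U) + 1 by rewrite ltr_wpDl.
have th_ge0 : 0 <= th by rewrite invr_ge0 ltW.
have th_le1 : th <= 1 by rewrite invf_le1// lerDr.
have th_L : th ^+ 2 * (U + 2 * eps) <= eps.
  have -> : U + 2 * eps = kappa eps U * eps by rewrite /kappa divfK// gt_eqF.
  rewrite mulrA ger_pMl// -[X in _ * X <= _](sqr_sqrtr (ltW (kappa_gt0 eps_gt0 U_ge0))).
  rewrite -exprMn exprn_ile1 ?mulr_ge0// /th mulrC ler_pdivrMr// mul1r lerDl//.
have := cg_slow_residual A_sym y0 r0 p0 yS rS pS eps_gt0 A_le reg th_ge0 th_le1 th_L strong J_gt0.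
rewrite -/(kappa eps U) -tauE// => rJ.
have dg_ge0 : 0 <= decay eps U J * enorm g.
  by apply: mulr_ge0; [exact: decay_ge0|exact: enorm_ge0].
rewrite -(ler_pXn2r (_ : 0 < 2)%N) ?nnegrE ?enorm_ge0 ?dg_ge0//.
rewrite exprMn sqr_decay//; apply: le_trans rJ _.
apply: ler_wpM2r; first exact: sqr_ge0.
apply: ler_wpM2r; last exact: bigT_ge.
by apply: exprn_ge0; apply: ltW; exact: tau_gt0.
Qed.

Lemma pending_leq j : pending j -> (j <= minn n J)%N.
Proof.
move=> pj; rewrite leq_min; apply/andP; split; rewrite leqNgt; apply/negP => ltj.
  exact: pending_dim (pending_le ltj pj).
exact: pending_J (pending_le ltj pj).
Qed.

Lemma ccg_terminates : exists res, ccg_returns H g eps zeta cmu M0 res.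
Proof.
apply: contrapT => none; apply: pending_dim.
suff: forall j, pending j by exact.
elim=> [|j IH] i; first by [].
rewrite ltnS leq_eqVlt => /predU1P[->|]; last exact: IH.
by move=> res tj; apply: none; exists res, j.
Qed.

(** The sharper count for SOL, where no iterate is regenerated, is recorded because short steps
    arise only there and their savings pay for calls of MEO. *)
Definition ccg_guarantee (res : ccg_result R n) : Prop :=
  match ccg_type res with
  | NC => ccg_d res != 0 /\ qform H (ccg_d res) <= - eps * enorm (ccg_d res) ^+ 2
  | SOL => [/\ (ccg_prods res <= (minn n J).+1)%N, ccg_d res != 0,
               eps * enorm (ccg_d res) ^+ 2 <= qform A (ccg_d res),
               dot g (ccg_d res) = - qform A (ccg_d res) &
               `|g + A *m ccg_d res| <= cmu]
  end.

Lemma low_curv_guarantee v : low_curv H eps v ->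
  v != 0 /\ qform H v <= - eps * enorm v ^+ 2.
Proof.
rewrite /low_curv -/A qform_Hbar => lc; split; last by lra.
by apply/eqP => v0; move: lc; rewrite v0 /qform mulmx0 dot0l enorm0 expr0n/= !mulr0 addr0 ltxx.
Qed.

Lemma ccg_returns_guarantee res : ccg_returns H g eps zeta cmu M0 res ->
  (ccg_prods res <= (2 * minn n J).+1)%N /\ ccg_guarantee res.
Proof.
move=> [j pj tj]; have jm := pending_leq pj; have regj := pending_regular pj.
have jm2 : (j.+1 <= (2 * minn n J).+1)%N by rewrite ltnS (leq_trans jm)// leq_pmull.
case: j pj tj jm regj jm2 => [|j] pj.
  by move=> [lc ->] _ _ /= _; split=> //; exact: low_curv_guarantee.
rewrite -/(test j.+1 res) testE.
case: ifP => [lc ->|ly] // ; first by move=> _ _ ?; split=> //; exact: low_curv_guarantee.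
case: ifP => [/andP[sm smoo] -> jm regj jm2|_].
  split=> //; rewrite /ccg_guarantee /=.
  have res_y := cg_residual y0 r0 yS rS j.+1.
  have ry := cg_r_y A_sym y0 r0 p0 yS rS pS regj (leqnn _).
  split=> //.
  (* For y^j = 0 the residual would still be g, against [zeta_hat] < 1. *)
  - apply/eqP => yj0; move: sm; apply/negP; rewrite -ltNge.
    rewrite res_y -/A yj0 mulmx0 addr0 gtr_pMl//.
    exact: zeta_hat_lt1.
  - exact: low_curvN.
  - rewrite /qform [in RHS]dotC; apply/eqP; rewrite -addr_eq0 -dotDl.
    by rewrite -res_y ry.
  - by rewrite -res_y.
case: ifP => [lc -> jm regj jm2|_]; first by split=> //; exact: low_curv_guarantee.
(* Test (4) may cost j + 1 products plus j for the regeneration, hence the factor 2. *)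
move=> [_ [i [prods [ij lc /andP[_ le_prods] ->]]]] jm _ _; split=> /=.
  by apply: leq_trans le_prods _; rewrite mul2n -addnn addSn ltnS leq_add.
exact: low_curv_guarantee.
Qed.

End CappedCG.

(** * One iteration *)

Section Scaling.
Context {R : realType} {n : nat}.
Implicit Types (x d v : 'cV[R]_n).

(** The relative displacement: by [Xbar_step_coord] coordinate i of x is multiplied by 1 +
    [barrier_dir x d i 0], so a sup norm below 1 preserves positivity. *)
Definition barrier_dir x d : 'cV[R]_n := Xinv x *m Xbar x *m d.

Lemma Xbar_coord x d i : (Xbar x *m d) i 0 = Num.min (x i 0) 1 * d i 0.
Proof. by rewrite mul_diag_col mxE. Qed.

Lemma barrier_dir_coord x d i :
  barrier_dir x d i 0 = (x i 0)^-1 * (Num.min (x i 0) 1 * d i 0).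
Proof. by rewrite /barrier_dir -mulmxA mul_diag_col mxE Xbar_coord. Qed.

Lemma barrier_dirZ x a d : barrier_dir x (a *: d) = a *: barrier_dir x d.
Proof. by rewrite /barrier_dir -scalemxAr. Qed.

Lemma dot_Xbar x d v : dot (Xbar x *m d) v = dot d (Xbar x *m v).
Proof. exact: dot_diag. Qed.

Lemma dot_Xinv x d v : dot (Xinv x *m d) v = dot d (Xinv x *m v).
Proof. exact: dot_diag. Qed.

Lemma min1_gt0 (t : R) : 0 < t -> 0 < Num.min t 1.
Proof. by move=> t0; rewrite lt_min t0 ltr01. Qed.

Lemma barrier_ratio x i : positive_vec x ->
  0 < (x i 0)^-1 * Num.min (x i 0) 1 <= 1.
Proof.
move=> x0; have xi := x0 i; rewrite mulr_gt0 ?invr_gt0 ?min1_gt0//=.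
by rewrite mulrC ler_pdivrMr// mul1r ge_min lexx.
Qed.

Lemma Xbar_dir_le x d : positive_vec x -> enorm (Xbar x *m d) <= enorm d.
Proof.
move=> x0; apply: enorm_le_coord => i; rewrite Xbar_coord normrM ler_piMl//.
by rewrite gtr0_norm ?min1_gt0// ge_min lexx orbT.
Qed.

Lemma barrier_dir_coord_le x d i : positive_vec x ->
  `|barrier_dir x d i 0| <= `|d i 0|.
Proof.
move=> x0; have /andP[q0 q1] := barrier_ratio i x0.
by rewrite barrier_dir_coord mulrA normrM ler_piMl// gtr0_norm.
Qed.

Lemma barrier_dir_le x d : positive_vec x -> enorm (barrier_dir x d) <= enorm d.
Proof. by move=> x0; apply: enorm_le_coord => i; exact: barrier_dir_coord_le. Qed.

Lemma norm_barrier_dir_le x d : positive_vec x -> `|barrier_dir x d| <= enorm d.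
Proof. by move=> x0; apply: le_trans (norm_le_enorm _) (barrier_dir_le d x0). Qed.

Lemma norm_barrier_dir_gt0 x d : positive_vec x -> d != 0 -> 0 < `|barrier_dir x d|.
Proof.
move=> x0; rewrite normr_gt0; apply: contraNneq => u0; apply/eqP/matrixP => i j.
rewrite ord1 mxE; have /matrixP/(_ i 0) := u0; rewrite barrier_dir_coord mxE mulrA => /eqP.
by rewrite mulf_eq0 gt_eqF//=; [move/eqP|have /andP[] := barrier_ratio i x0].
Qed.

Lemma Xbar_step_coord x d i : positive_vec x ->
  (x + Xbar x *m d) i 0 = x i 0 * (1 + barrier_dir x d i 0).
Proof.
move=> x0; have xi := x0 i; rewrite mxE Xbar_coord barrier_dir_coord.
by field; rewrite gt_eqF.
Qed.

Lemma positive_step x d b : positive_vec x -> `|barrier_dir x d| <= b -> b < 1 ->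
  positive_vec (x + Xbar x *m d).
Proof.
move=> x0 ub b1 i; rewrite Xbar_step_coord// mulr_gt0//.
have := le_trans (coord_le_norm (barrier_dir x d) i) ub.
by rewrite ler_norml => /andP[]; lra.
Qed.

End Scaling.

(** * Cubic model of the barrier function, and sufficient decrease *)

Section Barrier.
Context {R : realType} {n : nat}.
Variables (f : 'cV[R]_n -> R) (P : params R) (N : set 'cV[R]_n) (Lg LH : R).
Hypothesis fN : twice_lipschitz_differentiable f N Lg LH.
Hypotheses (eps_g01 : 0 < eps_g P < 1) (LH_gt0 : 0 < LH).
Implicit Types (x d v : 'cV[R]_n).

Lemma mu_gt0 : 0 < mu P.
Proof. by rewrite /mu divr_gt0//; case/andP: eps_g01. Qed.

Lemma mu_le1 : mu P <= 1.
Proof. by rewrite /mu; case/andP: eps_g01; lra. Qed.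

Lemma dot_scaled_grad x d : dot (scaled_grad f P x) d =
  dot (gradient f x) (Xbar x *m d) - mu P * \sum_i barrier_dir x d i 0.
Proof.
rewrite /scaled_grad /grad_phi dot_Xbar dotBl dotZl dot_Xinv; congr (_ - _ * _).
by rewrite mulmxA; apply: eq_bigr => i _; rewrite mxE mul1r.
Qed.

Lemma qform_scaled_hess_f x d :
  qform (scaled_hess_f f x) d = qform (hessian f x) (Xbar x *m d).
Proof. by rewrite /qform /scaled_hess_f -!mulmxA dot_Xbar. Qed.

Lemma qform_scaled_hess x d : qform (scaled_hess f P x) d =
  qform (hessian f x) (Xbar x *m d) + mu P * enorm (barrier_dir x d) ^+ 2.
Proof.
rewrite /qform /scaled_hess -!mulmxA -dot_Xbar /hess_phi mulmxDl dotDr.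
rewrite -scalemxAl dotZr -mulmxA -dot_Xinv sqr_enorm.
by rewrite /barrier_dir -mulmxA.
Qed.

(** The cubic term collects the Taylor remainder of f and that of the logarithms, summed by
    [sum_cube_le_enorm]; mu <= 1 removes the weight of the latter. *)
Lemma phi_step_le x d b : positive_vec x -> `|barrier_dir x d| <= b -> b < 1 ->
  (forall t : R, 0 <= t <= 1 -> N (x + t *: (Xbar x *m d))) ->
  phi f P (x + Xbar x *m d) <= phi f P x + dot (scaled_grad f P x) d +
    qform (scaled_hess f P x) d / 2 + (LH + (2 - b) / (1 - b) ^+ 2) / 6 * enorm d ^+ 3.
Proof.
move=> x0 ub b1 segN.
have LH_part : LH / 6 * enorm (Xbar x *m d) ^+ 3 <= LH / 6 * enorm d ^+ 3.
  rewrite ler_wpM2l ?divr_ge0 ?(ltW LH_gt0)//.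
  by apply: lerXn2r; rewrite ?nnegrE ?enorm_ge0 ?Xbar_dir_le.
have f_le := taylor_le fN segN.
set u := barrier_dir x d.
have b0 : 0 <= b by exact: le_trans ub.
have ln_sum : - \sum_i ln ((x + Xbar x *m d) i 0) <= - \sum_i ln (x i 0) -
    \sum_i u i 0 + enorm u ^+ 2 / 2 + enorm u ^+ 3 / (3 * (1 - b)).
  have sumu3 := sum_cube_le_enorm u.
  have : - \sum_i ln ((x + Xbar x *m d) i 0) <= \sum_i (- ln (x i 0) - u i 0 +
      u i 0 ^+ 2 / 2 + `|u i 0| ^+ 3 / (3 * (1 - b))).
    rewrite -sumrN; apply: ler_sum => i _.
    have ui : `|u i 0| <= b by exact: le_trans (coord_le_norm u i) ub.
    have ui1 : 0 < 1 + u i 0 by move: ui; rewrite ler_norml => /andP[]; lra.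
    rewrite Xbar_step_coord// lnM ?posrE//.
    by have := Nln_le ui b1; lra.
  move=> h; apply: le_trans h _; rewrite !big_split/= !sumrN -!mulr_suml lerD//.
    by rewrite sqr_enorm /dot; under [X in _ <= _ + X / 2]eq_bigr do rewrite -expr2.
  by rewrite ler_pM2r ?invr_gt0 ?mulr_gt0 ?subr_gt0.
have u3 : mu P * (enorm u ^+ 3 / (3 * (1 - b))) <=
    (2 - b) / (1 - b) ^+ 2 / 6 * enorm d ^+ 3.
  have b1' : 0 < 1 - b by rewrite subr_gt0.
  have ud : enorm u ^+ 3 <= enorm d ^+ 3.
    by apply: lerXn2r; rewrite ?nnegrE ?enorm_ge0 ?barrier_dir_le.
  (* Rounds 2 - 2 b up to 2 - b, to reach the form of the constant in [c_denom]. *)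
  have c_le : (3 * (1 - b))^-1 <= (2 - b) / (1 - b) ^+ 2 / 6.
    have -> : (3 * (1 - b))^-1 = (2 * (1 - b)) / (1 - b) ^+ 2 / 6.
      by field; rewrite gt_eqF.
    rewrite ler_pM2r ?invr_gt0// ler_pM2r ?invr_gt0 ?exprn_gt0//; lra.
  have u3_ge0 : 0 <= enorm u ^+ 3 by rewrite exprn_ge0 ?enorm_ge0.
  have d3_ge0 : 0 <= enorm d ^+ 3 by rewrite exprn_ge0 ?enorm_ge0.
  have c_ge0 : 0 <= (3 * (1 - b))^-1 by rewrite invr_ge0 mulr_ge0// ltW.
  apply: le_trans (_ : 1 * (enorm u ^+ 3 / (3 * (1 - b))) <= _).
    by rewrite ler_wpM2r ?mu_le1// mulr_ge0.
  by rewrite mul1r [leRHS]mulrC; apply: ler_pM.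
have := ler_wpM2l (ltW mu_gt0) ln_sum.
rewrite /phi dot_scaled_grad qform_scaled_hess -/u; lra.
Qed.

Hypotheses (theta01 : 0 < theta P < 1) (eta01 : 0 < decr_eta P < 1).
Hypothesis beta_range : Num.sqrt (eps_g P) <= beta P < 1.

Lemma eps_H_gt0 : 0 < eps_H P.
Proof. by rewrite /eps_H sqrtr_gt0; case/andP: eps_g01. Qed.

Lemma sqr_eps_H : eps_H P ^+ 2 = eps_g P.
Proof. by rewrite /eps_H sqr_sqrtr// ltW//; case/andP: eps_g01. Qed.

Lemma eps_H_lt1 : eps_H P < 1.
Proof. by case/andP: eps_g01 => _ g1; rewrite /eps_H -[ltRHS]sqrtr1 ltr_sqrt. Qed.

Let beta_lt1 : beta P < 1. Proof. by case/andP: beta_range. Qed.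
Let eps_H_le_beta : eps_H P <= beta P. Proof. by case/andP: beta_range. Qed.
Let beta_gt0 : 0 < beta P := lt_le_trans eps_H_gt0 eps_H_le_beta.
Let eta_gt0 : 0 < decr_eta P. Proof. by case/andP: eta01. Qed.
Let theta_gt0 : 0 < theta P. Proof. by case/andP: theta01. Qed.

(* Cubic coefficient of the upper model of phi along a step, plus eta. *)
Definition cubic_const : R := LH + (2 - beta P) / (1 - beta P) ^+ 2 + decr_eta P.

Lemma cubic_const_gt0 : 0 < cubic_const.
Proof.
have b1 : 0 < 1 - beta P by rewrite subr_gt0.
rewrite /cubic_const !addr_gt0// divr_gt0 ?exprn_gt0//; have := beta_lt1; lra.
Qed.

Lemma c_denomE : c_denom P LH = cubic_const * (1 - beta P) ^+ 2.
Proof.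
rewrite /c_denom /cubic_const; field.
by rewrite gt_eqF// subr_gt0.
Qed.

Lemma step_length01 j : 0 < theta P ^+ j <= 1.
Proof. by case/andP: theta01 => t0 t1; rewrite exprn_gt0//= exprn_ile1// ltW. Qed.

Lemma trialE x d j : trial P x d j = x + Xbar x *m (theta P ^+ j *: d).
Proof. by rewrite /trial scalemxAr. Qed.

Definition segment_in x d : Prop := forall j (t : R), 0 <= t <= 1 ->
  N (x + t *: (trial P x d j - x)).

Lemma trial_phi_le x d j : positive_vec x -> `|barrier_dir x d| <= beta P ->
  segment_in x d ->
  phi f P (trial P x d j) <= phi f P x + theta P ^+ j * dot (scaled_grad f P x) d +
    (theta P ^+ j) ^+ 2 * qform (scaled_hess f P x) d / 2 +
    (cubic_const - decr_eta P) / 6 * ((theta P ^+ j) ^+ 3 * enorm d ^+ 3).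
Proof.
move=> x0 ub segN; have /andP[a0 a1] := step_length01 j; rewrite trialE.
have ub' : `|barrier_dir x (theta P ^+ j *: d)| <= beta P.
  by rewrite barrier_dirZ normrZ gtr0_norm// (le_trans _ ub)// ler_piMl.
have segN' (t : R) : 0 <= t <= 1 -> N (x + t *: (Xbar x *m (theta P ^+ j *: d))).
  by move=> /(segN j); rewrite trialE addrAC subrr add0r.
have := phi_step_le x0 ub' beta_lt1 segN'.
rewrite dotZr qformZ enormZ gtr0_norm// exprMn.
by rewrite /cubic_const addrK.
Qed.

(** With a = theta^j the curvature contributes at most - a^2 |d|^3 / 2, which dominates K a^3 |d|^3
    / 6 as soon as a K < 3: the origin of the 3 in [c_nc]. *)
Lemma decreases_nc x d j : positive_vec x -> `|barrier_dir x d| <= beta P ->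
  segment_in x d -> d != 0 -> dot (scaled_grad f P x) d <= 0 ->
  qform (scaled_hess f P x) d <= - enorm d ^+ 3 ->
  theta P ^+ j * cubic_const < 3 -> decreases f P x d j.
Proof.
move=> x0 ub segN d0 gd Hd small; apply: le_lt_trans (trial_phi_le j x0 ub segN) _.
have /andP[] := step_length01 j; move: small; set a := theta P ^+ j => small a0 a1.
have D_gt0 : 0 < enorm d ^+ 3 by rewrite exprn_gt0 ?enorm_gt0.
have a2_gt0 : 0 < a ^+ 2 by rewrite exprn_gt0.
have agd : a * dot (scaled_grad f P x) d <= 0 by rewrite pmulr_rle0.
have := ler_wpM2l (ltW a2_gt0) Hd.
have : 0 < a ^+ 2 * enorm d ^+ 3 * (3 - a * cubic_const).
  by rewrite mulr_gt0 ?subr_gt0// mulr_gt0.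
have -> : a ^+ 3 = a ^+ 2 * a by rewrite -exprSr.
lra.
Qed.

(** Replacing the scaled Hessian by [Hbar] minus 2 eps_H leaves a term - eps_H a^2 D^2, with a =
    theta^j and D the length of the direction. It dominates K a^3 D^3 / 6 when a D K < 6 eps_H: the
    origin of the 6 in [c_sol]. *)
Lemma decreases_sol x dh s j : positive_vec x -> `|barrier_dir x (s *: dh)| <= beta P ->
  segment_in x (s *: dh) -> dh != 0 -> 0 < s <= 1 ->
  eps_H P * enorm dh ^+ 2 <= qform (Hbar (scaled_hess f P x) (eps_H P)) dh ->
  dot (scaled_grad f P x) dh = - qform (Hbar (scaled_hess f P x) (eps_H P)) dh ->
  theta P ^+ j * enorm (s *: dh) * cubic_const < 6 * eps_H P ->
  decreases f P x (s *: dh) j.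
Proof.
move=> x0 ub segN d0 /andP[s0 s1] Qge gd small.
apply: le_lt_trans (trial_phi_le j x0 ub segN) _.
have /andP[] := step_length01 j; move: small; set a := theta P ^+ j => small a0 a1.
have e0 := eps_H_gt0.
rewrite dotZr gd qformZ.
move: Qge gd; rewrite qform_Hbar; set Q := qform _ _ => Qge gd.
set D := enorm (s *: dh) in small *.
have D_gt0 : 0 < D by rewrite enorm_gt0 scaler_eq0 negb_or gt_eqF.
have D2 : D ^+ 2 = s ^+ 2 * enorm dh ^+ 2 by rewrite /D enormZ exprMn gtr0_norm.
have Q1_gt0 : 0 < Q + 2 * eps_H P * enorm dh ^+ 2.
  by apply: lt_le_trans Qge; rewrite mulr_gt0// exprn_gt0 ?enorm_gt0.
have as_gt0 : 0 < a * s by rewrite mulr_gt0.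
have as_le1 : a * s <= 1 by rewrite mulr_ile1// ltW.
have h1 : 0 < a * s * (2 - a * s) * (Q + 2 * eps_H P * enorm dh ^+ 2).
  by rewrite !mulr_gt0// subr_gt0 (le_lt_trans as_le1)// ltr1n.
have h2 : 0 < a ^+ 2 * D ^+ 2 * (6 * eps_H P - a * D * cubic_const).
  by rewrite mulr_gt0 ?subr_gt0// mulr_gt0 ?exprn_gt0.
have h3 : a ^+ 2 * D ^+ 2 * eps_H P = a ^+ 2 * (s ^+ 2 * enorm dh ^+ 2) * eps_H P.
  by rewrite D2.
have -> : a ^+ 3 = a ^+ 2 * a by rewrite -exprSr.
have -> : D ^+ 3 = D ^+ 2 * D by rewrite -exprSr.
lra.
Qed.

(** If a positive index is selected, its predecessor failed and so violates the sufficient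
    condition; this costs one factor theta. Geometric decay excludes an endless search. *)
Lemma line_search_bound x d ls (K B : R) : 0 < K -> 0 < B ->
  (forall j, theta P ^+ j * K < B -> decreases f P x d j) ->
  line_search f P x d ls ->
  exists j, [/\ ls = Some j, decreases f P x d j &
                j = 0%N \/ theta P * B <= theta P ^+ j * K].
Proof.
move=> K0 B0 dec; case: ls => [j|] /=.
  move=> [dj ndj]; exists j; split=> //.
  case: j dj ndj => [|j] _ ndj; [by left|right].
  rewrite exprS -mulrA ler_pM2l// leNgt; apply/negP => /dec.
  exact: ndj.
have BK : 0 < B / K by rewrite divr_gt0.
have t1 : `|theta P| < 1 by rewrite gtr0_norm//; case/andP: theta01.
have /cvgr0Pnorm_lt/(_ _ BK)[j _ /(_ j (leqnn j))/= small] := cvg_expr t1.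
move=> /(_ j) nd; case: nd; apply: dec.
by rewrite -ltr_pdivlMr//; exact: le_lt_trans (ler_norm _) small.
Qed.

(** Whichever entry attains the minimum, d is long: the curvature ratio gives at least k0, the cap
    gives at least beta. Being at most the curvature ratio, the scaling turns the curvature of dh
    into - |d|^3. *)
Lemma nc_direction_props x dh d s (k0 : R) : positive_vec x -> dh != 0 ->
  0 < k0 <= beta P -> qform (scaled_hess f P x) dh <= - k0 * enorm dh ^+ 2 ->
  is_sgn s (dot (scaled_grad f P x) dh) ->
  d = - (s * Num.min (`|qform (scaled_hess f P x) dh| / enorm dh ^+ 3)
                     (max_step P x dh)) *: dh ->
  [/\ k0 <= enorm d, `|barrier_dir x d| <= beta P, d != 0,
      dot (scaled_grad f P x) d <= 0 &
      qform (scaled_hess f P x) d <= - enorm d ^+ 3].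
Proof.
move=> x0 dh0 /andP[k0_gt0 k0b] Hd sgn_s ->.
have dh_gt0 : 0 < enorm dh by rewrite enorm_gt0.
have u_gt0 := norm_barrier_dir_gt0 x0 dh0.
have u_le := norm_barrier_dir_le dh x0.
move: Hd; set q := qform (scaled_hess f P x) dh => Hd.
have q_lt0 : q < 0 by apply: le_lt_trans Hd _; rewrite mulNr oppr_lt0 mulr_gt0 ?exprn_gt0.
have absq : `|q| = - q by rewrite ltr0_norm.
set sg := Num.min _ _.
have max_gt0 : 0 < max_step P x dh by rewrite divr_gt0.
have sg_gt0 : 0 < sg by rewrite lt_min max_gt0 andbT divr_gt0 ?exprn_gt0// absq oppr_gt0.
have s1 : `|s| = 1 by case: sgn_s => -[-> _]; rewrite ?normrN normr1.
have ssg : `|- (s * sg)| = sg by rewrite normrN normrM s1 mul1r gtr0_norm.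
have d_norm : enorm (- (s * sg) *: dh) = sg * enorm dh by rewrite enormZ ssg.
have s2 : (s * sg) ^+ 2 = sg ^+ 2.
  by rewrite exprMn -[s ^+ 2]real_normK ?num_real// s1 expr1n mul1r.
have sgq : sg * enorm dh ^+ 3 <= - q.
  by rewrite -ler_pdivlMr ?exprn_gt0// -absq ge_min lexx.
split.
- rewrite d_norm -ler_pdivrMr// le_min; apply/andP; split.
    rewrite absq ler_pdivlMr ?exprn_gt0// mulrAC ler_pdivrMr//.
    have -> : enorm dh ^+ 3 = enorm dh ^+ 2 * enorm dh by rewrite -exprSr.
    by rewrite mulrA ler_pM2r//; move: Hd; lra.
  rewrite /max_step -/(barrier_dir x dh) ler_pdivlMr// mulrAC ler_pdivrMr//.
  by apply: ler_pM => //; exact: ltW.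
- rewrite barrier_dirZ normrZ ssg -ler_pdivlMr//.
  by rewrite ge_min /max_step lexx orbT.
- by rewrite -enorm_gt0 d_norm mulr_gt0.
- rewrite dotZr mulNr oppr_le0 mulrAC mulr_ge0 ?(ltW sg_gt0)//.
  by case: sgn_s => -[-> h]; rewrite ?mul1r// mulN1r oppr_ge0.
- rewrite qformZ -/q sqrrN s2 d_norm exprMn.
  have -> : sg ^+ 3 = sg ^+ 2 * sg by rewrite -exprSr.
  have := ler_wpM2l (sqr_ge0 sg) sgq; lra.
Qed.

End Barrier.

(** * First-order conditions after a short unit step *)

Section UnitStep.
Context {R : realType}.
Implicit Types (e m z t u rho dd D T G w xi : R).

(** One coordinate of the residual equation: xi is x_i, u its relative displacement, rho the
    residual, G the new gradient and w its Taylor error. All terms are multiples of e^2 adding up to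
    at most 7/10, and rescaling to the new point costs at most 37/36. *)
Lemma unit_step_scalar e m z xi u dd rho D T G w :
  0 < e < 1 -> m = e ^+ 2 / 4 -> 0 < z < 1 -> 0 < xi ->
  `|rho| <= z * m -> u = xi^-1 * (Num.min xi 1 * dd) -> `|dd| <= D ->
  D <= (1 - z) * e / 36 -> T <= 3 / 64 * e ^+ 2 -> `|w| <= T ->
  Num.min xi 1 * (G - w) = rho + m * (xi^-1 * Num.min xi 1) * (1 - u) - 2 * e * dd ->
  - e ^+ 2 < G /\ `|Num.min (xi * (1 + u)) 1 * G| <= e ^+ 2.
Proof.
move=> /andP[e0 e1] -> /andP[z0 z1] xi0; set b := Num.min xi 1.
have b0 : 0 < b by exact: min1_gt0.
have b1 : b <= 1 by rewrite ge_min lexx orbT.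
have bx : b <= xi by rewrite ge_min lexx.
set q := xi^-1 * b.
have q0 : 0 < q by rewrite mulr_gt0// invr_gt0.
have q1 : q <= 1 by rewrite /q mulrC ler_pdivrMr// mul1r.
move=> rho_le uE dd_le D_le T_le w_le.
have D_ge0 : 0 <= D by exact: le_trans dd_le.
have u_le : `|u| <= D.
  apply: le_trans dd_le; rewrite uE mulrA -/q normrM gtr0_norm// ler_piMl//.
have e2 : 0 < e ^+ 2 by rewrite exprn_gt0.
have D_e : D <= e / 36.
  apply: le_trans D_le _; rewrite ler_pM2r ?invr_gt0// ler_piMl ?ltW//; lra.
have eD : e * D <= (1 - z) * e ^+ 2 / 36.
  by have := ler_wpM2l (ltW e0) D_le; lra.
have eeD : e ^+ 2 * D <= e * D.
  by rewrite ler_wpM2r// expr2 ler_piMl// ltW.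
have ze2 : 0 < z * e ^+ 2 by rewrite mulr_gt0.
have ze2' : z * e ^+ 2 <= e ^+ 2 by rewrite ler_piMl// ltW.
move: rho_le u_le dd_le w_le; rewrite !ler_norml => /andP[r1 r2] /andP[u1 u2].
move=> /andP[d1 d2] /andP[w1 w2] GE.
have edd1 : - (e * D) <= e * dd by rewrite -mulrN ler_wpM2l// ltW.
have edd2 : e * dd <= e * D by rewrite ler_wpM2l// ltW.
have u36 : - (1 / 36) <= u /\ u <= 1 / 36 by lra.
have u_pos : 0 < 1 - u by lra.
have mq_ge0 : 0 <= e ^+ 2 / 4 * q * (1 - u).
  by apply: mulr_ge0 (ltW u_pos); apply: mulr_ge0 (ltW q0); rewrite divr_ge0 ?(ltW e2).
have mq_le : e ^+ 2 / 4 * q * (1 - u) <= e ^+ 2 / 4 * (37 / 36).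
  rewrite -mulrA ler_pM2l ?divr_gt0//.
  by apply: le_trans (_ : 1 * (1 - u) <= _); [rewrite ler_pM2r|lra].
have bw1 : - T <= b * w.
  apply: le_trans (_ : b * - T <= _); last by rewrite ler_pM2l.
  by rewrite mulrN lerN2 ler_piMl//; lra.
have bw2 : b * w <= T.
  apply: le_trans (_ : b * T <= _); first by rewrite ler_pM2l.
  by rewrite ler_piMl//; lra.
have bG1 : - (7 / 10 * e ^+ 2) <= b * G by lra.
have bG2 : b * G <= 7 / 10 * e ^+ 2 by lra.
split.
  have [xi1|xi1] := leP 1 xi.
    by have b_1 : b = 1 by [rewrite /b min_r]; move: bG1; rewrite b_1 mul1r; lra.
  (* For small xi, dividing the bound on b G by b would lose too much. Instead, the barrier term m
     beats the residual tolerance z m and the terms in D, so that G >= w. *)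
  have bxi : b = xi by rewrite /b min_l// ltW.
  have q_1 : q = 1 by rewrite /q bxi mulVf// gt_eqF.
  have : 0 <= b * (G - w).
    rewrite GE q_1.
    have eu : e ^+ 2 * u <= e ^+ 2 * D by rewrite ler_pM2l.
    lra.
  by rewrite pmulr_rge0//; lra.
have u1_gt0 : 0 < 1 + u by lra.
have xu_gt0 : 0 < Num.min (xi * (1 + u)) 1 by rewrite min1_gt0// mulr_gt0.
have min_le : Num.min (xi * (1 + u)) 1 <= 37 / 36 * b.
  have [xi1|xi1] := leP 1 xi.
    have b_1 : b = 1 by rewrite /b min_r.
    apply: le_trans (_ : 1 <= _); last by rewrite b_1; lra.
    by rewrite ge_min lexx orbT.
  have -> : b = xi by rewrite /b min_l// ltW.
  apply: le_trans (_ : xi * (1 + u) <= _).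
    by rewrite ge_min lexx.
  by rewrite mulrC ler_pM2r//; lra.
rewrite -ler_norml normrM gtr0_norm//.
apply: le_trans (_ : 37 / 36 * b * `|G| <= _); first by rewrite ler_wpM2r.
rewrite -mulrA -[X in X * `|G|](gtr0_norm b0) -normrM.
have : `|b * G| <= 7 / 10 * e ^+ 2 by rewrite ler_norml bG1.
lra.
Qed.

End UnitStep.

Section Step.
Context {R : realType} {n : nat}.
Variables (f : 'cV[R]_n -> R) (P : params R) (N : set 'cV[R]_n) (Lg LH : R).
Hypothesis fN : twice_lipschitz_differentiable f N Lg LH.
Hypotheses (eps_g01 : 0 < eps_g P < 1) (LH_gt0 : 0 < LH).
Hypotheses (theta01 : 0 < theta P < 1) (eta01 : 0 < decr_eta P < 1).
Hypothesis beta_range : Num.sqrt (eps_g P) <= beta P < 1.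
Hypotheses (zeta_r01 : 0 < zeta_r P < 1) (zeta_bar01 : 0 < zeta_bar P < 1).
Implicit Types (x d v : 'cV[R]_n).

Let e := eps_H P.
Let c := c_all P LH.
Let e_gt0 : 0 < e := eps_H_gt0 eps_g01.
Let e_lt1 : e < 1 := eps_H_lt1 eps_g01.
Let e_beta : e <= beta P. Proof. by case/andP: beta_range. Qed.
Let K := cubic_const P LH.
Let K_gt0 : 0 < K := cubic_const_gt0 LH_gt0 eta01 beta_range.
Let b1 : 0 < 1 - beta P. Proof. by case/andP: beta_range => _; rewrite subr_gt0. Qed.
Let theta_gt0 : 0 < theta P. Proof. by case/andP: theta01. Qed.

Let denomE : c_denom P LH = K * (1 - beta P) ^+ 2 := c_denomE LH beta_range.

Lemma c_all_le : [/\ c <= (1 - zeta_bar P) / 9, c <= Num.sqrt (3 / (2 * LH)),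
  c <= 6 * theta P ^+ 2 / K, c <= 3 * theta P / K & c <= 1].
Proof.
have E2 : 6 * (1 - beta P) ^+ 2 * theta P ^+ 2 / c_denom P LH = 6 * theta P ^+ 2 / K.
  by rewrite denomE; field; rewrite !gt_eqF.
have E3 : 3 * (1 - beta P) ^+ 2 * theta P / c_denom P LH = 3 * theta P / K.
  by rewrite denomE; field; rewrite !gt_eqF.
have : c <= c_all P LH by [].
rewrite {1}/c_all /c_sol /c_nc /c_d E2 E3 !le_min.
by move=> /andP[/andP[/andP[-> /andP[-> _]] ->] /andP[-> ->]].
Qed.

Lemma c_all_gt0 : 0 < c.
Proof.
have cd : 0 < c_denom P LH by rewrite denomE mulr_gt0// exprn_gt0.
have [zr0 _] := andP zeta_r01; have [_ zb1] := andP zeta_bar01.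
have b2 : 0 < (1 - beta P) ^+ 2 by rewrite exprn_gt0.
have t2 : 0 < theta P ^+ 2 by rewrite exprn_gt0.
have h1 : 0 < (1 - zeta_bar P) / 9 by rewrite divr_gt0// subr_gt0.
have h2 : 0 < Num.sqrt (3 / (2 * LH)) by rewrite sqrtr_gt0 divr_gt0// mulr_gt0.
have h3 : 0 < 1 / (2 * (LH + 9 / 2 + zeta_r P)).
  by rewrite divr_gt0// mulr_gt0//; have := LH_gt0; lra.
have h4 : 0 < 6 * (1 - beta P) ^+ 2 * theta P ^+ 2 / c_denom P LH.
  by apply: divr_gt0 => //; apply: mulr_gt0 => //; exact: mulr_gt0.
have h5 : 0 < 3 * (1 - beta P) ^+ 2 * theta P / c_denom P LH.
  by apply: divr_gt0 => //; apply: mulr_gt0 => //; exact: mulr_gt0.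
by rewrite /c /c_all /c_sol /c_nc /c_d !lt_min h1 h2 h3 h4 h5 ltr01.
Qed.

Let mu_eq : mu P = e ^+ 2 / 4. Proof. by rewrite /mu -(sqr_eps_H eps_g01). Qed.

Lemma residual_coord x d i : positive_vec x ->
  (scaled_grad f P x + Hbar (scaled_hess f P x) e *m d) i 0 =
  Num.min (x i 0) 1 * (gradient f x i 0 + (hessian f x *m (Xbar x *m d)) i 0) -
  mu P * ((x i 0)^-1 * Num.min (x i 0) 1) * (1 - barrier_dir x d i 0) + 2 * e * d i 0.
Proof.
move=> x0; have xi := x0 i; have xi0 : x i 0 != 0 by rewrite gt_eqF.
have addE (u v : 'cV[R]_n) : (u + v) i 0 = u i 0 + v i 0 by rewrite mxE.
have scaleE a (u : 'cV[R]_n) : (a *: u) i 0 = a * u i 0 by rewrite mxE.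
have gradE : scaled_grad f P x i 0 = Num.min (x i 0) 1 * (gradient f x i 0 - mu P * (x i 0)^-1).
  rewrite /scaled_grad Xbar_coord /grad_phi addE -scaleN1r !scaleE mulN1r.
  by rewrite mul_diag_col !mxE mulr1.
have hessE : (scaled_hess f P x *m d) i 0 = Num.min (x i 0) 1 *
    ((hessian f x *m (Xbar x *m d)) i 0 +
     mu P * ((x i 0)^-1 * ((x i 0)^-1 * (Num.min (x i 0) 1 * d i 0)))).
  rewrite /scaled_hess -!mulmxA Xbar_coord /hess_phi mulmxDl addE -scalemxAl scaleE.
  by rewrite -mulmxA mul_diag_col mul_diag_col Xbar_coord !mxE.
rewrite /Hbar mulmxDl mul_scalar_mx !addE scaleE gradE hessE barrier_dir_coord.
by field.
Qed.

Lemma small_unit_step x d : positive_vec x -> N x ->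
  (forall t : R, 0 <= t <= 1 -> N (x + t *: (Xbar x *m d))) ->
  `|scaled_grad f P x + Hbar (scaled_hess f P x) e *m d| <= c_mu P ->
  enorm d < c * e / 4 -> ~ calls_ccg f P (x + Xbar x *m d).
Proof.
move=> x0 Nx segN res small.
have [cz cL _ _ c1] := c_all_le; have c0 := c_all_gt0.
set D := enorm d in small; set T := LH / 2 * D ^+ 2.
(* This is the use of the entry (1 - zeta_bar) / 9 of [c_d]. *)
have D_le : D <= (1 - zeta_bar P) * e / 36.
  have := ler_wpM2r (ltW e_gt0) cz; lra.
(* The square root in [c_d] gives LH c^2 <= 3/2, hence LH D^2 / 2 <= 3 e^2 / 64 for D <= c e / 4. *)
have T_le : T <= 3 / 64 * e ^+ 2.
  have c2 : c ^+ 2 <= 3 / (2 * LH).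
    rewrite -(@sqr_sqrtr _ (3 / (2 * LH))) ?divr_ge0 ?mulr_ge0 ?(ltW LH_gt0)//.
    by apply: lerXn2r; rewrite ?nnegrE ?sqrtr_ge0 ?(ltW c0).
  have D2 : D ^+ 2 <= (c * e / 4) ^+ 2.
    by apply: lerXn2r; rewrite ?nnegrE ?enorm_ge0 ?(ltW small)// !mulr_ge0 ?(ltW c0) ?(ltW e_gt0).
  have : LH * c ^+ 2 <= 3 / 2.
    rewrite mulrC -ler_pdivlMr//; apply: le_trans c2 _.
    by rewrite le_eqVlt; apply/orP; left; apply/eqP; field; rewrite gt_eqF.
  move=> /(ler_wpM2r (sqr_ge0 e)) h.
  have := ler_wpM2l (ltW LH_gt0) D2; rewrite /T !exprMn; lra.
have key i : - e ^+ 2 < gradient f (x + Xbar x *m d) i 0 /\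
    `|Num.min ((x + Xbar x *m d) i 0) 1 * gradient f (x + Xbar x *m d) i 0| <= e ^+ 2.
  have dotd v : dot (delta_mx i 0) v = v i 0.
    rewrite /dot (bigD1 i)//= mxE !eqxx mul1r big1 ?addr0// => k ki.
    by rewrite mxE (negbTE ki) mul0r.
  have ed : enorm (delta_mx i 0 : 'cV[R]_n) = 1.
    by rewrite /enorm dotd mxE !eqxx sqrtr1.
  have := taylor_gradient_norm fN (delta_mx i 0) segN; rewrite !dotd ed mulr1.
  set G := gradient f (x + _) i 0 => w_le.
  rewrite Xbar_step_coord//.
  apply: (@unit_step_scalar _ e (mu P) (zeta_bar P) _ _ (d i 0) _ D T G
    (G - gradient f x i 0 - (hessian f x *m (Xbar x *m d)) i 0)) => //.
  - by rewrite e_gt0.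
  - exact: le_trans (coord_le_norm _ i) res.
  - exact: barrier_dir_coord.
  - exact: coord_le_enorm.
  - apply: le_trans w_le _; rewrite /T ler_wpM2l ?divr_ge0 ?(ltW LH_gt0)//.
    by apply: lerXn2r; rewrite ?nnegrE ?enorm_ge0 ?Xbar_dir_le.
  - by rewrite residual_coord//; ring.
move=> [[i]|]; rewrite -(sqr_eps_H eps_g01).
  by rewrite leNgt; have [-> _] := key i.
apply/negP; rewrite -leNgt; apply: norm_le_coord => [|i]; first exact: sqr_ge0.
by rewrite Xbar_coord; have [_] := key i.
Qed.

End Step.

(** * Progress of one iteration *)

Section Progress.
Context {R : realType} {n : nat}.
Variables (f : 'cV[R]_n -> R) (P : params R) (N : set 'cV[R]_n) (Lg LH UH : R).
Hypothesis fN : twice_lipschitz_differentiable f N Lg LH.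
Hypotheses (N_open : open N) (eps_g01 : 0 < eps_g P < 1) (LH_gt0 : 0 < LH).
Hypotheses (theta01 : 0 < theta P < 1) (eta01 : 0 < decr_eta P < 1).
Hypothesis beta_range : Num.sqrt (eps_g P) <= beta P < 1.
Hypotheses (zeta_r01 : 0 < zeta_r P < 1) (zeta_bar01 : 0 < zeta_bar P < 1).
Hypothesis hMhat : Mhat_valid f P.
Implicit Types (x d v : 'cV[R]_n) (o : outcome R n).

Let e := eps_H P.
Let c := c_all P LH.
Let e_gt0 : 0 < e := eps_H_gt0 eps_g01.
Let e_lt1 : e < 1 := eps_H_lt1 eps_g01.
Let e_beta : e <= beta P. Proof. by case/andP: beta_range. Qed.
Let beta_gt0 : 0 < beta P := lt_le_trans e_gt0 e_beta.
Let K := cubic_const P LH.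
Let K_gt0 : 0 < K := cubic_const_gt0 LH_gt0 eta01 beta_range.
Let theta_gt0 : 0 < theta P. Proof. by case/andP: theta01. Qed.
Let c_le := c_all_le LH_gt0 eta01 beta_range.
Let c_gt0 : 0 < c := c_all_gt0 LH_gt0 theta01 eta01 beta_range zeta_r01 zeta_bar01.
Let mu_eq : mu P = e ^+ 2 / 4. Proof. by rewrite /mu -(sqr_eps_H eps_g01). Qed.

Let ce_le : c * e / 4 <= e / 4.
Proof. by rewrite -mulrA ler_piMl ?divr_ge0 ?(ltW e_gt0)//; case: c_le. Qed.

(** The line search loses at most a factor c, through 3 theta / K if it backtracks and c <= 1
    otherwise. The parameter k0 is eps_H for CCG and eps_H / 4 for MEO. *)
Lemma nc_progress x dh d s (k0 : R) ls : positive_vec x -> dh != 0 ->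
  e / 4 <= k0 <= beta P -> qform (scaled_hess f P x) dh <= - k0 * enorm dh ^+ 2 ->
  is_sgn s (dot (scaled_grad f P x) dh) ->
  d = - (s * Num.min (`|qform (scaled_hess f P x) dh| / enorm dh ^+ 3)
                     (max_step P x dh)) *: dh ->
  segment_in P N x d -> line_search f P x d ls ->
  exists j, [/\ ls = Some j, decreases f P x d j, `|barrier_dir x d| <= beta P &
                c * e / 4 <= theta P ^+ j * enorm d].
Proof.
move=> x0 dh0 /andP[k0e k0b] Hd sgn_s dE segN ls_ok.
have k0_gt0 : 0 < k0 by apply: lt_le_trans k0e; rewrite divr_gt0.
have k0_range : 0 < k0 <= beta P by rewrite k0_gt0.
have [k0d ud d0 gd qd] :=
  nc_direction_props eps_g01 beta_range x0 dh0 k0_range Hd sgn_s dE.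
have dec j := @decreases_nc _ _ f P N Lg LH fN eps_g01 LH_gt0 theta01 beta_range
  x d j x0 ud segN d0 gd qd.
have [j [lsj dj good]] := line_search_bound theta01 K_gt0 (ltr0Sn _ 2) dec ls_ok.
exists j; split=> //.
apply: le_trans (_ : c * k0 <= _).
  by rewrite -mulrA ler_pM2l// ; apply: le_trans k0e; rewrite mulrC.
apply: ler_pM => //; [exact: ltW|exact: ltW|].
have [_ _ _ c3 c1] := c_le.
case: good => [->|]; first by rewrite expr0.
by rewrite -ler_pdivrMr// => h; apply: le_trans c3 (le_trans _ h); rewrite (mulrC 3).
Qed.

(** A short step survives only if neither the line search nor the cap shortened it: backtracking is
    covered by 6 theta^2 / K, and a capped direction has length at least beta >= eps_H. *)
Lemma sol_progress x dh ls : positive_vec x -> N x -> dh != 0 ->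
  e * enorm dh ^+ 2 <= qform (Hbar (scaled_hess f P x) e) dh ->
  dot (scaled_grad f P x) dh = - qform (Hbar (scaled_hess f P x) e) dh ->
  `|scaled_grad f P x + Hbar (scaled_hess f P x) e *m dh| <= c_mu P ->
  let d := Num.min 1 (max_step P x dh) *: dh in
  segment_in P N x d -> line_search f P x d ls ->
  exists j, [/\ ls = Some j, decreases f P x d j, `|barrier_dir x d| <= beta P &
                c * e / 4 <= theta P ^+ j * enorm d \/ ~ calls_ccg f P (trial P x d j)].
Proof.
move=> x0 Nx dh0 Qd gd res; set s := Num.min _ _ => d segN ls_ok.
have u_gt0 := norm_barrier_dir_gt0 x0 dh0.
have u_le := norm_barrier_dir_le dh x0.
have dh_gt0 : 0 < enorm dh by rewrite enorm_gt0.
have max_gt0 : 0 < max_step P x dh by rewrite divr_gt0.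
have s_gt0 : 0 < s by rewrite lt_min ltr01.
have s_le1 : s <= 1 by rewrite ge_min lexx.
have s01 : 0 < s <= 1 by rewrite s_gt0.
have ud : `|barrier_dir x d| <= beta P.
  by rewrite barrier_dirZ normrZ gtr0_norm// -ler_pdivlMr// ge_min /max_step lexx orbT.
have d_gt0 : 0 < enorm d by rewrite enormZ gtr0_norm// mulr_gt0.
have dec j (small : theta P ^+ j * (enorm d * K) < 6 * e) : decreases f P x d j.
  by apply: (decreases_sol fN eps_g01 LH_gt0 theta01 beta_range x0 ud segN dh0 s01 Qd gd);
    rewrite -mulrA.
have [||j [lsj dj good]] := line_search_bound theta01 _ _ dec ls_ok.
- by rewrite mulr_gt0.
- by rewrite mulr_gt0.
exists j; split=> //.
case: good => [j0|long]; last first.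
  left; have [_ _ c2 _ _] := c_le.
  apply: le_trans (_ : c * e <= _).
    by rewrite ler_pdivrMr// ler_peMr ?ler1n// mulr_ge0 ?(ltW c_gt0) ?(ltW e_gt0).
  apply: le_trans (_ : 6 * theta P ^+ 2 / K * e <= _); first by rewrite ler_pM2r.
  rewrite mulrAC ler_pdivrMr// -[leRHS]mulrA; apply: le_trans long.
  have e6 : 0 <= 6 * e by rewrite mulr_ge0// ltW.
  have t2 : theta P ^+ 2 <= theta P.
    by rewrite expr2 ler_piMr ?(ltW theta_gt0)// ltW//; case/andP: theta01.
  by have := ler_wpM2r e6 t2; lra.
rewrite j0 expr0 mul1r.
have [s1|s1] := ltP s 1.
  left; have sE : s = max_step P x dh.
    rewrite /s min_r// leNgt; apply/negP => h.
    by move: s1; rewrite /s min_l ?ltxx// ltW.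
  apply: le_trans (le_trans ce_le _) (_ : beta P <= _).
    by apply: le_trans e_beta; rewrite ler_pdivrMr// ler_peMr ?ler1n// ltW.
  rewrite enormZ gtr0_norm// sE /max_step -/(barrier_dir x dh) mulrAC ler_pdivlMr//.
  by rewrite ler_pM2l.
have dE : d = dh by rewrite /d (_ : s = 1) ?scale1r//; apply/eqP; rewrite eq_le s_le1.
have [big|small] := leP (c * e / 4) (enorm d); [by left|right].
have t0E : trial P x d 0 = x + Xbar x *m d by rewrite trialE expr0 scale1r.
rewrite t0E; apply: (small_unit_step fN eps_g01 LH_gt0 theta01 eta01 beta_range
  zeta_r01 zeta_bar01 x0 Nx) => //; last by rewrite dE.
by move=> t t01; have := segN 0%N t t01; rewrite t0E addrAC subrr add0r.
Qed.

(** CCG requires g nonzero. If it vanished, the gradient would be positive and each coordinate of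
    [Xbar x *m gradient f x] at most mu = eps_g / 4, so that CCG would not be called. *)
Lemma scaled_grad_neq0 x : positive_vec x -> calls_ccg f P x -> scaled_grad f P x != 0.
Proof.
move=> x0 call; apply/eqP => g0.
have mu0 := mu_gt0 eps_g01.
have key i : Num.min (x i 0) 1 * gradient f x i 0 =
    mu P * ((x i 0)^-1 * Num.min (x i 0) 1).
  have /matrixP/(_ i 0) := g0; rewrite /scaled_grad Xbar_coord /grad_phi.
  rewrite mxE [X in _ * (_ + X)]mxE [X in _ * (_ - X)]mxE mul_diag_col !mxE mulr1.
  rewrite mulrBr => /eqP; rewrite subr_eq0 => /eqP ->.
  ring.
case: call => [[i]|].
  have b0 := min1_gt0 (x0 i); have /andP[q0 _] := barrier_ratio i x0.
  have gi : 0 < gradient f x i 0 by rewrite -(pmulr_rgt0 _ b0) key mulr_gt0.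
  move=> /(lt_le_trans gi); rewrite oppr_gt0 ltNge ltW//.
  by case/andP: eps_g01.
apply/negP; rewrite -leNgt; apply: norm_le_coord => [|i].
  by case/andP: eps_g01 => /ltW.
rewrite Xbar_coord key; have /andP[q0 q1] := barrier_ratio i x0.
rewrite gtr0_norm; last exact: mulr_gt0.
apply: (@le_trans _ _ (mu P)); first by rewrite ler_piMr// ltW.
by rewrite /mu; case/andP: eps_g01; lra.
Qed.

Lemma scaled_hess_sym x : N x -> (scaled_hess f P x)^T = scaled_hess f P x.
Proof.
move=> Nx; have hs := hessian_sym fN N_open Nx (ltW LH_gt0).
rewrite /scaled_hess /hess_phi !trmx_mul linearD linearZ /= trmx_mul.
by rewrite !tr_diag_mx hs mulmxA.
Qed.

Lemma scaled_hess_le x v : positive_vec x -> opnorm (hessian f x) <= UH ->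
  qform (scaled_hess f P x) v <= (UH + mu P) * enorm v ^+ 2.
Proof.
move=> x0 hU; rewrite qform_scaled_hess [leRHS]mulrDl lerD//.
  apply: le_trans (qform_le _ _) _; apply: ler_pM => //; first exact: opnorm_ge0.
    exact: sqr_ge0.
  by apply: lerXn2r; rewrite ?nnegrE ?enorm_ge0 ?Xbar_dir_le.
rewrite ler_pM2l ?mu_gt0//.
by apply: lerXn2r; rewrite ?nnegrE ?enorm_ge0 ?barrier_dir_le.
Qed.

Lemma M_mu_ge0 : 0 <= M_mu P.
Proof.
rewrite /M_mu; have mu0 := mu_gt0 eps_g01.
case E: (Mhat P) => [M|] /=; last by rewrite add0r ltW.
by have [M0 _] := hMhat E; rewrite ltW// addr_gt0.
Qed.

Lemma c_mu_gt0 : 0 < c_mu P.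
Proof. by rewrite /c_mu mulr_gt0 ?mu_gt0//; case/andP: zeta_bar01. Qed.

Definition ccg_index x : nat :=
  J_index (eps_H P) (zeta_r P) (c_mu P) (UH + mu P) (enorm (scaled_grad f P x)).

(* The two alternatives: a step of length at least c_all eps_H / 4, or a
   short unit step, after which CCG is not called. *)
Definition step_progress x o d j : Prop :=
  [/\ direction o = Some d, next_iterate P x o = Some (trial P x d j),
      decreases f P x d j & `|barrier_dir x d| <= beta P] /\
  ((c * e / 4 <= theta P ^+ j * enorm d /\
    (is_ccg o -> (cost o <= 2 * minn n (ccg_index x) + 2)%N)) \/
   [/\ is_ccg o, ~ calls_ccg f P (trial P x d j), (0 < ccg_index x)%N &
       (cost o <= minn n (ccg_index x) + 2)%N]).

Lemma iteration_progress x o : positive_vec x -> N x ->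
  (forall d, direction o = Some d -> segment_in P N x d) ->
  opnorm (hessian f x) <= UH ->
  (calls_ccg f P x -> ccg_M_le (scaled_hess f P x) (scaled_grad f P x)
     (eps_H P) (zeta_r P) (c_mu P) (M_mu P) (UH + mu P)) ->
  iteration_spec f P x o ->
  (exists prods, o = MEOCert prods) \/ exists d j, step_progress x o d j.
Proof.
move=> x0 Nx segN hU ccgM.
have hs := scaled_hess_sym Nx.
have hle v := scaled_hess_le v x0 hU.
have ccg_ok : calls_ccg f P x -> (exists res, ccg_call_returns f P x res) /\
    forall res, ccg_call_returns f P x res ->
      (ccg_prods res <= (2 * minn n (ccg_index x)).+1)%N /\
      ccg_guarantee (scaled_hess f P x) (scaled_grad f P x) (eps_H P) (zeta_r P)
        (c_mu P) (UH + mu P) res.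
  move=> call; have g0 := scaled_grad_neq0 x0 call; split.
    exact: ccg_terminates hs g0 e_gt0 zeta_r01 c_mu_gt0 M_mu_ge0.
  move=> res; exact: (ccg_returns_guarantee hs g0 e_gt0 zeta_r01 c_mu_gt0 M_mu_ge0
    hle (ccgM call)).
case: o segN => [res d ls||lambda v prods d ls|prods] segN.
- move=> [call ret dir lsx].
  have [_ guar] := ccg_ok call.
  have [prods_le res_ok] := guar _ ret.
  have seg := segN d erefl.
  right; exists d.
  move: dir res_ok; rewrite /ccg_direction /ccg_guarantee; case: (ccg_type res).
    move=> [s sgn_s dE] [dh0 Hd].
    have k0 : e / 4 <= e <= beta P.
      by rewrite e_beta andbT ler_pdivrMr// ler_peMr ?ler1n// ltW.
    have [j [-> dj ud good]] := nc_progress x0 dh0 k0 Hd sgn_s dE seg lsx.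
    exists j; split=> //; left; split=> // _ /=.
    by rewrite addn2 ltnS.
  move=> dE [prods_le' dh0 Qd gd res_le]; rewrite dE in seg lsx *.
  have [j [-> dj ud good]] := sol_progress x0 Nx dh0 Qd gd res_le seg lsx.
  exists j; split; first by [].
  case: good => good; [left|right].
    by split; [exact: good|move=> _; rewrite /= addn2 ltnS; exact: prods_le].
  split; [exact: isT|exact: good| |rewrite /= addn2 ltnS; exact: prods_le'].
  have mU : 0 <= UH + mu P.
    exact: addr_ge0 (le_trans (opnorm_ge0 _) hU) (ltW (mu_gt0 eps_g01)).
  have g_gt0 : 0 < enorm (scaled_grad f P x) by rewrite enorm_gt0 scaled_grad_neq0.
  exact: (J_index_gt0 e_gt0 zeta_r01 c_mu_gt0 mU g_gt0).
- by move=> [call none]; have [[res ret] _] := ccg_ok call; case: (none res).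
- move=> [ncall [lam v1 qv] [s sgn_s dE] lsx].
  right; exists d.
  have v0 : v != 0 by rewrite -enorm_gt0 v1.
  (* The barrier adds at most mu = e^2 / 4 <= e / 4 to the curvature - e / 2 found by MEO. *)
  have Hv : qform (scaled_hess f P x) v <= - (e / 4) * enorm v ^+ 2.
    rewrite v1 expr1n mulr1 qform_scaled_hess -qform_scaled_hess_f qv.
    have u1 : enorm (barrier_dir x v) ^+ 2 <= 1.
      by rewrite exprn_ile1 ?enorm_ge0// -v1 barrier_dir_le.
    have e2 : e ^+ 2 <= e by rewrite expr2 ler_piMl ?(ltW e_gt0) ?(ltW e_lt1).
    have := ler_wpM2l (ltW (mu_gt0 eps_g01)) u1; rewrite mulr1 mu_eq => h.
    by move: lam; rewrite -/e; lra.
  have k0 : e / 4 <= e / 4 <= beta P.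
    by rewrite lexx (le_trans _ e_beta)// ler_pdivrMr// ler_peMr ?ler1n// ltW.
  have [j [-> dj ud good]] : exists j, [/\ ls = Some j, decreases f P x d j,
      `|barrier_dir x d| <= beta P & c * e / 4 <= theta P ^+ j * enorm d].
    apply: (nc_progress x0 v0 k0 Hv (s := s)) => //; first by rewrite dotC.
    - by rewrite v1 expr1n divr1.
    - exact: segN.
  by exists j; split=> //; left.
- by move=> _; left; exists prods.
Qed.

End Progress.

(** * Counting iterations *)

Section Counting.
Context {R : realType}.
Implicit Types (s t : R).

Lemma long_step_gain s t : 0 <= t <= s ->
  3 * (t ^+ 3 / 24) <= s ^+ 3 / 6 - t ^+ 2 * s / 24.
Proof.
move=> /andP[t0 ts]; rewrite -subr_ge0.
have s0 : 0 <= s by exact: le_trans ts.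
have -> : s ^+ 3 / 6 - t ^+ 2 * s / 24 - 3 * (t ^+ 3 / 24) =
  (s - t) * (s ^+ 2 / 6 + s * t / 6 + t ^+ 2 / 8) by field.
apply: mulr_ge0; first by rewrite subr_ge0.
have := sqr_ge0 s; have := sqr_ge0 t; have : 0 <= s * t by exact: mulr_ge0.
lra.
Qed.

Lemma any_step_gain s t : 0 <= s -> 0 <= t ->
  - (t ^+ 3 / 24) <= s ^+ 3 / 6 - t ^+ 2 * s / 24.
Proof.
move=> s0 t0; have [ts|st] := leP t s.
  have := @long_step_gain s t; rewrite t0 ts => /(_ isT).
  have : 0 <= t ^+ 3 by exact: exprn_ge0.
  lra.
have : t ^+ 2 * s <= t ^+ 3.
  by rewrite [leRHS]exprSr ler_wpM2l ?sqr_ge0// ltW.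
have : 0 <= s ^+ 3 by exact: exprn_ge0.
lra.
Qed.

Lemma ln_le_tangent s t : 0 < s -> 0 < t -> ln s <= ln t + s / t - 1.
Proof.
move=> s0 t0; have st : 0 < s / t by rewrite divr_gt0.
have -> : ln s = ln t + ln (s / t) by rewrite -lnM ?posrE// mulrC divfK// gt_eqF.
rewrite -addrA lerD2l; have := @le_ln1Dx R (s / t - 1).
by rewrite addrCA subrr addr0; apply; lra.
Qed.

End Counting.

(* C + 1 is the cost of a call of MEO including the gradient evaluation; the
   excess is absorbed by short steps, which cost at most C - 1, and by the
   factor 3 with which long steps enter K. *)
Lemma total_budget (S q C K N g b m : nat) :
  (S + b <= N * C + m -> q <= C.+1 -> (0 < N -> 3 * g + 3 <= K + b) -> 2 <= K ->
  2 <= C -> b <= g.+1 -> m <= g -> g + b = N -> S + q <= C * K)%N.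
Proof.
move=> S_le q_le gap K2 C2 bg mg gbN.
(* t counts iterations left below K after the N + 1 used. Each is worth C >= 2 units, enough to pay
   for the extra unit of every call of MEO, the final one included. *)
have [t [tK tm]] : exists t, (N.+1 + t <= K /\ m + 1 <= b + 2 * t)%N.
  case: N gbN gap {S_le} => [|N] gbN gap; first by exists 1%N; lia.
  by exists (2 * (g.+1 - b))%N; have := gap isT; lia.
have : ((N.+1 + t) * C <= K * C)%N by rewrite leq_mul2r tK orbT.
have : (t * 2 <= t * C)%N by rewrite leq_mul2l C2 orbT.
by rewrite mulnDl mulSn (mulnC C); lia.
Qed.

(** * Merit function, length and cost of a run *)

Section Run.
Context {R : realType} {n : nat}.
Variables (f : 'cV[R]_n -> R) (P : params R) (x0 : 'cV[R]_n).
Variables (Lg LH flow Ug UH : R) (r : run R n).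
Hypotheses (n_gt0 : (0 < n)%N) (eps_g01 : 0 < eps_g P < 1) (LH_gt0 : 0 < LH).
Hypotheses (theta01 : 0 < theta P < 1) (eta01 : 0 < decr_eta P < 1).
Hypothesis beta_range : Num.sqrt (eps_g P) <= beta P < 1.
Hypotheses (zeta_r01 : 0 < zeta_r P < 1) (zeta_bar01 : 0 < zeta_bar P < 1).
Hypotheses (hMhat : Mhat_valid f P) (x0_gt0 : positive_vec x0).
Hypotheses (hrun : is_run f P x0 r) (A1 : assumption1 f P Lg LH r).
Hypotheses (A2 : assumption2 f flow) (A3 : assumption3 f P Ug UH r).
Hypothesis hM : ccg_M_bounded f P UH r.

Let e := eps_H P.
Let c := c_all P LH.
Let eta := decr_eta P.
Let omega := omega2 P LH x0.
Let e_gt0 : 0 < e := eps_H_gt0 eps_g01.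
Let c_gt0 : 0 < c := c_all_gt0 LH_gt0 theta01 eta01 beta_range zeta_r01 zeta_bar01.
Let eta_gt0 : 0 < eta. Proof. by case/andP: eta01. Qed.
Let mu_gt0' : 0 < mu P := mu_gt0 eps_g01.
Let mu_eq : mu P = e ^+ 2 / 4. Proof. by rewrite /mu -(sqr_eps_H eps_g01). Qed.

Let t := c * e / 4.
Let u := eta * (t ^+ 3 / 24).
Let t_gt0 : 0 < t. Proof. by rewrite divr_gt0// mulr_gt0. Qed.
Let u_gt0 : 0 < u. Proof. by rewrite mulr_gt0// divr_gt0// exprn_gt0. Qed.

Let path_const : R := 96 * Num.sqrt n%:R / (eta * c ^+ 2).

Let path_const_gt0 : 0 < path_const.
Proof.
apply: divr_gt0; first by rewrite mulr_gt0// sqrtr_gt0 ltr0n.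
by rewrite mulr_gt0// exprn_gt0.
Qed.

Let omega_gt0 : 0 < omega.
Proof. by rewrite /omega /omega2 lt_max path_const_gt0. Qed.

Let x0_omega i : x0 i 0 <= omega.
Proof.
apply: le_trans (ler_norm _) (le_trans (coord_le_norm x0 i) _).
by rewrite /omega /omega2 le_max lexx orbT.
Qed.

(** Explains the 96 in omega_2: with mu = e^2 / 4 and t = c e / 4, both sides agree when omega
    equals [path_const], as 24 * 16 / 4 = 96. *)
Lemma path_coef_le : mu P / omega * Num.sqrt n%:R <= eta * (t ^+ 2 / 24).
Proof.
have om : path_const <= omega by rewrite /omega /omega2 le_max lexx.
rewrite mulrAC ler_pdivrMr//.
apply: le_trans (_ : eta * (t ^+ 2 / 24) * path_const <= _); last first.
  by rewrite ler_pM2l// mulr_gt0// divr_gt0// exprn_gt0.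
rewrite le_eqVlt; apply/orP; left; apply/eqP; rewrite mu_eq /t /path_const.
by field; rewrite !gt_eqF.
Qed.

Definition merit x : R := phi f P x + mu P / omega * \sum_i x i 0.

Lemma reached_le k l : (k <= l)%N -> reached P r l -> reached P r k.
Proof. by move=> kl rl j jk; apply: rl; exact: leq_trans kl. Qed.

Lemma merit_decrease x d j : positive_vec x -> decreases f P x d j ->
  merit (trial P x d j) < merit x -
    eta * ((theta P ^+ j * enorm d) ^+ 3 / 6 - t ^+ 2 * (theta P ^+ j * enorm d) / 24).
Proof.
move=> xp dec; set s := theta P ^+ j * enorm d.
have /andP[a0 _] := step_length01 theta01 j.
have sum_le : \sum_i trial P x d j i 0 <= \sum_i x i 0 + Num.sqrt n%:R * s.
  have -> : \sum_i trial P x d j i 0 = \sum_i x i 0 + \sum_i (Xbar x *m (theta P ^+ j *: d)) i 0.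
    by rewrite -big_split trialE; apply: eq_bigr => i _; rewrite mxE.
  rewrite lerD2l; apply: le_trans (sum_le_enorm _) _.
  rewrite ler_wpM2l ?sqrtr_ge0//; apply: le_trans (Xbar_dir_le _ xp) _.
  by rewrite enormZ gtr0_norm.
have s0 : 0 <= s by rewrite mulr_ge0 ?enorm_ge0 ?(ltW a0).
have mo : 0 < mu P / omega by rewrite divr_gt0.
have := ler_wpM2l (ltW mo) sum_le; have := ler_wpM2r s0 path_coef_le.
move: dec; rewrite /decreases -/eta -mulrA -exprMn -/s /merit; lra.
Qed.

Lemma merit_lower x : positive_vec x -> flow - mu P * (n%:R * (ln omega - 1)) <= merit x.
Proof.
move=> xp; have := A2 x.
have : mu P * \sum_i ln (x i 0) <= mu P * \sum_i (ln omega - 1 + x i 0 / omega).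
  rewrite ler_pM2l//; apply: ler_sum => i _.
  by have := ln_le_tangent (xp i) omega_gt0; lra.
rewrite big_split/= sumr_const card_ord -mulr_suml -mulr_natl /merit /phi; lra.
Qed.

(** The entry |x^0| of omega_2 bounds the linear term by mu n, which cancels against the -1 of the
    tangent inequality in [merit_lower]; only the difference of logarithms is left in K_2. *)
Lemma merit_init : merit x0 <= f x0 + mu P * n%:R *
  (1 - inf (range (fun i : 'I_n => ln (x0 i 0)))).
Proof.
rewrite /merit /phi; set m := inf _.
have m_le i : m <= ln (x0 i 0).
  apply: ge_inf; last by exists i.
  exists (- \sum_i `|ln (x0 i 0)|) => _ [k _ <-].
  rewrite lerNl; apply: le_trans (ler_norm _) _; rewrite normrN (bigD1 k)//= lerDl.
  exact: sumr_ge0.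
have h1 : n%:R * m <= \sum_i ln (x0 i 0).
  have -> : n%:R * m = \sum_(i < n) m by rewrite sumr_const card_ord mulr_natl.
  exact: ler_sum.
have h2 : \sum_i x0 i 0 <= n%:R * omega.
  have -> : n%:R * omega = \sum_(i < n) omega by rewrite sumr_const card_ord mulr_natl.
  exact: ler_sum.
have := ler_wpM2l (ltW mu_gt0') h1.
have mo : 0 < mu P / omega by rewrite divr_gt0.
have := ler_wpM2l (ltW mo) h2.
have -> : mu P / omega * (n%:R * omega) = mu P * n%:R by field; rewrite gt_eqF.
lra.
Qed.

(** Explains 1536 = 24 * 4^3: [K2_real] is the initial gap measured in units of u. *)
Lemma K2_realE : K2_real f P LH flow x0 = (f x0 - flow + mu P * n%:R *
  (ln omega - inf (range (fun i : 'I_n => ln (x0 i 0))))) / u.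
Proof.
rewrite /K2_real -/omega -/eta -/c powRN.
have -> : eps_g P `^ (3 / 2) = e ^+ 3.
  rewrite mulrC powRrM powR12_sqrt; last by case/andP: eps_g01 => /ltW.
  by rewrite powR_mulrn ?sqrtr_ge0.
rewrite /u /t; field; by rewrite !gt_eqF.
Qed.

(** The strict inequality between integers gains one unit and the + 2 of K_2 the other two. *)
Lemma merit_gap_lt (g b : nat) x : positive_vec x ->
  merit x < merit x0 - (3 * g%:R - b%:R) * u -> (3 * g + 3 <= K2 f P LH flow x0 + b)%N.
Proof.
move=> xp lt_merit; have lo := merit_lower xp; have hi := merit_init.
have : 3 * g%:R - b%:R < K2_real f P LH flow x0.
  by rewrite K2_realE ltr_pdivlMr//; lra.
rewrite /K2; set K := K2_real _ _ _ _ _ => gK.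
have aux (z : nat) : (3 * g < z + b)%N -> (3 * g + 3 <= z + 2 + b)%N by clear; lia.
apply: aux.
rewrite -(ltr_nat R) natrD natrM -ltrBlDr.
apply: lt_le_trans gK (le_trans (ceil_ge K) _).
by rewrite natr_absz ler_int ler_norm.
Qed.

Lemma progress_at k : reached P r k -> positive_vec (iterate r k) ->
  (exists prods, out r k = MEOCert prods) \/
  exists d j, step_progress f P LH UH (iterate r k) (out r k) d j.
Proof.
move=> rk xp; have [N [oN Nit Nseg fN]] := A1.
have [spec _] := (proj2 hrun) k rk.
have [_ hU] := A3 rk.
apply: (iteration_progress fN oN) => //.
- exact: Nit.
- by move=> d dk j t' t01; exact: Nseg.
- exact: hM.
Qed.

Lemma reachedS k : reached P r k.+1 -> reached P r k /\
  exists y, next_iterate P (iterate r k) (out r k) = Some y /\ iterate r k.+1 = y.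
Proof.
move=> rk1; have rk := reached_le (leqnSn k) rk1; split=> //.
have := rk1 k (ltnSn k).
case E: next_iterate => [y|] // _; exists y; split=> //.
by have [_] := (proj2 hrun) k rk; apply.
Qed.

(** The bounds are parameters because [J_max] depends on the last iteration, which is not known
    during the induction on k. *)
Definition cost_budget (C J Nm k : nat) : Prop :=
  [/\ (2 * minn n J + 2 <= C)%N, (Nm <= C)%N,
      (forall j, (j < k)%N -> is_ccg (out r j) -> (ccg_index f P UH (iterate r j) <= J)%N) &
      (forall j prods, (j < k)%N -> meo_prods (out r j) = Some prods -> (prods <= Nm)%N)].

(* g counts the long steps, m <= g those made by MEO, b the short ones. *)
Lemma run_invariant k : reached P r k -> positive_vec (iterate r k) /\
  exists g b m, [/\ (g + b)%N = k, (m <= g)%N,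
    (b <= g)%N \/ b = g.+1 /\ ~ calls_ccg f P (iterate r k),
    (0 < k)%N -> merit (iterate r k) < merit x0 - (3 * g%:R - b%:R) * u &
    forall C J Nm, cost_budget C J Nm k ->
      (\sum_(j < k) cost (out r j) + b <= k * C + m)%N].
Proof.
elim: k => [|k IH] rk.
  rewrite (proj1 hrun); split=> //; exists 0%N, 0%N, 0%N; split=> //; first by left.
  by move=> C J Nm _; rewrite big_ord0.
have [rk0 [y [nextE ->]]] := reachedS rk.
have [xp [g [b [m [gbk mg gb lt_merit le_cost]]]]] := IH rk0.
(* At k = 0 the invariant offers no strict inequality, but equality holds with g = b = 0. *)
have le_merit : merit (iterate r k) <= merit x0 - (3 * g%:R - b%:R) * u.
  case: k gbk lt_merit {IH rk rk0 nextE xp gb le_cost} => [|k] gbk lt_merit;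
    last exact/ltW/lt_merit.
  have [-> ->] : g = 0%N /\ b = 0%N by move: gbk; clear; lia.
  by rewrite (proj1 hrun) mulr0 subrr mul0r subr0.
have [[prods E]|[d [j [[dirE nextE' dec ud] alt]]]] := progress_at rk0 xp.
  by move: nextE; rewrite E.
have {nextE nextE'} yE : y = trial P (iterate r k) d j.
  by move: nextE; rewrite nextE' => -[].
have beta_lt1 : beta P < 1 by case/andP: beta_range.
have yp : positive_vec y.
  have /andP[a0 a1] := step_length01 theta01 j.
  rewrite yE trialE; apply: (positive_step xp _ beta_lt1).
  by rewrite barrier_dirZ normrZ gtr0_norm// (le_trans _ ud)// ler_piMl.
split=> //.
have md := merit_decrease xp dec; rewrite -yE in md.
have /andP[a0 _] := step_length01 theta01 j.
have s0 : 0 <= theta P ^+ j * enorm d by rewrite mulr_ge0 ?enorm_ge0 ?(ltW a0).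
move: md alt; set s := theta P ^+ j * enorm d in s0 * => md.
have budgetS C J Nm : cost_budget C J Nm k.+1 -> cost_budget C J Nm k.
  by move=> [h1 h2 h3 h4]; split=> // [i ik|i p ik]; [apply: h3|apply: h4]; rewrite ltnS ltnW.
case=> [[long cost_ccg]|[ccg_k ncall idx_gt0 cost_le]].
  have gain : eta * (3 * (t ^+ 3 / 24)) <= eta * (s ^+ 3 / 6 - t ^+ 2 * s / 24).
    by rewrite ler_pM2l// long_step_gain// (ltW t_gt0).
  exists g.+1, b, (m + ~~ is_ccg (out r k))%N; split.
  - by rewrite addSn gbk.
  - by rewrite -addn1 leq_add// leq_b1.
  - by left; case: gb => [gb|[-> _]] //; exact: leqW.
  - by move=> _; move: le_merit gain md; rewrite /u -[g.+1%:R]natr1; lra.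
  - move=> C J Nm bud; have := le_cost _ _ _ (budgetS _ _ _ bud).
    case: bud => h1 h2 h3 h4; rewrite big_ord_recr /=.
    (* A call of MEO may exceed C by its gradient evaluation; m keeps track of this. *)
    have ck : (cost (out r k) <= C + ~~ is_ccg (out r k))%N.
      have [cc|ncc] := boolP (is_ccg (out r k)).
        rewrite addn0 (leq_trans (cost_ccg cc))// (leq_trans _ h1)// leq_add2r leq_mul2l/=.
        rewrite leq_min geq_minl (leq_trans (geq_minr _ _))// h3//.
      case E: (out r k) ncc => [| |lam v prods d' ls|prods] //= _;
        by rewrite addn1 ltnS (leq_trans _ h2)// (h4 k) ?E.
    move: ck; clear; lia.
have gain : eta * (- (t ^+ 3 / 24)) <= eta * (s ^+ 3 / 6 - t ^+ 2 * s / 24).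
  by rewrite ler_pM2l// any_step_gain// ltW.
have call_k : calls_ccg f P (iterate r k).
  have [spec _] := (proj2 hrun) k rk0; move: spec ccg_k.
  by case: (out r k) => [? ? ?||? ? ? ? ?|?] //= [].
exists g, b.+1, m; split.
- by rewrite addnS gbk.
- by [].
(* The excess b = g + 1 means that the last step was short and CCG is not called now, so a further
   short step can occur only from b <= g. *)
- by case: gb => [gb|[_ //]]; case: (ltnP b g) => [|gb'];
    [left|right; split; [apply/eqP; rewrite eqSS eqn_leq gb|rewrite yE]].
- by move=> _; move: le_merit gain md; rewrite /u -[b.+1%:R]natr1; lra.
- move=> C J Nm bud; have := le_cost _ _ _ (budgetS _ _ _ bud).
  case: bud => h1 h2 h3 h4; rewrite big_ord_recr /=.
  have := h3 k (ltnSn k) ccg_k.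
  (* As n and the index are positive, min(n, J) + 2 is at most C - 1: a short step saves one
     unit. *)
  move: cost_le h1 idx_gt0 n_gt0; clear; lia.
Qed.

(** From k = g + b, b <= g + 1 and 3 g + 3 <= K_2 + b. The terminating iteration is included, so the
    failure events of index below K_2 cover every call of MEO. *)
Lemma reached_lt_K2 k : reached P r k -> (k < K2 f P LH flow x0)%N.
Proof.
move=> rk; have [xp [g [b [m [gbk mg gb lt_merit _]]]]] := run_invariant rk.
case: k rk xp gbk gb lt_merit => [|k] rk xp gbk gb lt_merit; first by rewrite /K2 addn2.
have := merit_gap_lt xp (lt_merit (ltn0Sn k)).
by move: gb gbk => [|[+ _]]; clear; lia.
Qed.

Lemma run_terminates : exists N, terminates_at P r N.
Proof.
apply: contrapT => noN.
have all_reached k : reached P r k.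
  elim: k => [|k rk] // j; rewrite ltnS leq_eqVlt => /predU1P[->|]; last exact: rk.
  have [xp _] := run_invariant rk.
  have [[prods E]|[d [l [[_ -> _ _] _]]]] := progress_at rk xp; last by [].
  by case: noN; exists k; split=> //; exists prods.
by have := reached_lt_K2 (all_reached (K2 f P LH flow x0)); rewrite ltnn.
Qed.

Lemma terminates_first_order N : terminates_at P r N -> first_order f P (iterate r N).
Proof.
move=> [rN [prods E]]; have [xp _] := run_invariant rN.
have [spec _] := (proj2 hrun) N rN; move: spec; rewrite E /= => ncall.
split=> // [i|].
  by rewrite leNgt; apply/negP => h; apply: ncall; left; exists i; exact: ltW.
by rewrite leNgt; apply/negP => h; apply: ncall; right.
Qed.

Lemma terminates_cost N (Nm : nat) : terminates_at P r N ->
  (forall k prods, reached P r k -> meo_prods (out r k) = Some prods -> (prods <= Nm)%N) ->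
  (total_cost r N <= maxn (2 * minn n (J_max f P UH r N) + 2) Nm * K2 f P LH flow x0)%N.
Proof.
move=> [rN [prods E]] hNm; set C := maxn _ _; set K := K2 _ _ _ _ _.
have [xp [g [b [m [gbk mg gb lt_merit le_cost]]]]] := run_invariant rN.
have C1 : (2 * minn n (J_max f P UH r N) + 2 <= C)%N by exact: leq_maxl.
have C2 : (Nm <= C)%N by exact: leq_maxr.
have bud : cost_budget C (J_max f P UH r N) Nm N.
  split=> // [j jN cj|j p jN]; last by apply: hNm; exact: reached_le (ltnW jN) rN.
  apply: (@leq_bigmax_cond _ (fun k : 'I_N.+1 => is_ccg (out r k))
    (fun k => ccg_index f P UH (iterate r k)) (Ordinal (leqW jN)) cj).
have S_le := le_cost _ _ _ bud.
rewrite /total_cost big_ord_recr /=.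
have cN : (cost (out r N) <= C.+1)%N by rewrite E /= ltnS (leq_trans _ C2)// (hNm N)// E.
have gap : (0 < N)%N -> (3 * g + 3 <= K + b)%N by move=> N0; exact: merit_gap_lt xp (lt_merit N0).
have K_ge2 : (2 <= K)%N by rewrite /K /K2 addn2.
have C_ge2 : (2 <= C)%N by apply: leq_trans C1; rewrite leq_addl.
have gb' : (b <= g.+1)%N by case: gb => [|[-> _]]; [exact: leqW|].
exact: total_budget S_le cN gap K_ge2 C_ge2 gb' mg gbk.
Qed.

End Run.

(** * Probability of success *)

Section Survival.
Context {R : realType} {n : nat}.
Variables (f : 'cV[R]_n -> R) (P : params R) (C delta : R).
Context {dsp : measure_display} {Omega : measurableType dsp}.
Variables (Pr : probability Omega R) (X : Omega -> run R n).
Hypotheses (A4 : assumption4 f P C Pr X delta) (delta01 : 0 <= delta < 1).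

Let failed := meo_failed f P C X.

Definition no_failure k : set Omega := [set w | forall j, (j < k)%N -> ~ failed j w].

Lemma no_failure0 : no_failure 0 = setT.
Proof. by apply/seteqP; split. Qed.

Lemma no_failureS k : no_failure k.+1 = no_failure k `\` failed k.
Proof.
apply/seteqP; split=> w /=.
  by move=> h; split; [move=> j jk; apply: h; exact: ltnW|exact: h].
by move=> [h hk] j; rewrite ltnS leq_eqVlt => /predU1P[->|]; [exact: hk|exact: h].
Qed.

Lemma failed_history j k : (j < k)%N -> history f P C X k (failed j).
Proof. by move=> jk; apply: sub_sigma_algebra => /=; apply: Or33; exists j. Qed.

(** Past success belongs to the history, so the conditional bound may be applied on the event that
    MEO is called and no earlier call has failed. *)
Lemma no_failure_history j k : (j <= k)%N -> history f P C X k (no_failure j).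
Proof.
elim: j => [|j IH] jk.
  by rewrite no_failure0; exact: (@measurableT _ (g_sigma_algebraType _)).
rewrite no_failureS; apply: (@measurableD _ (g_sigma_algebraType _)).
  exact: (IH (ltnW jk)).
exact: failed_history.
Qed.

Lemma measurable_failed k : measurable (failed k).
Proof. exact: (proj1 A4 k.+1 _ (failed_history (ltnSn k))). Qed.

Lemma measurable_no_failure k : measurable (no_failure k).
Proof. exact: (proj1 A4 k _ (no_failure_history (leqnn k))). Qed.

Lemma failed_called k : failed k `<=` meo_called P X k.
Proof. by move=> w [rk]; rewrite /meo_called /=; case: (out _ _) => //. Qed.

Lemma called_history k : history f P C X k (meo_called P X k).
Proof. by apply: sub_sigma_algebra => /=; apply: Or32; exists k. Qed.

(** Each iteration removes at most a fraction delta of the surviving probability, since failures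
    occur only where MEO is called; an iteration without such a call removes nothing. *)
Lemma prob_no_failure k : (((1 - delta) ^+ k)%:E <= Pr (no_failure k))%E.
Proof.
have [d0 d1] := andP delta01.
elim: k => [|k IH]; first by rewrite no_failure0 probability_setT expr0.
have mS := measurable_no_failure k; have mF := measurable_failed k.
have finite (A : set Omega) : measurable A -> Pr A \is a fin_num by exact: fin_num_measure.
have mSF := measurableI _ _ mS mF.
have PrD : Pr (no_failure k `\` failed k) =
    (fine (Pr (no_failure k)) - fine (Pr (no_failure k `&` failed k)))%:E.
  by rewrite measureD// ?ltey_eq ?finite// EFinB !fineK ?finite.
rewrite no_failureS PrD.
have hE : history f P C X k (no_failure k `&` meo_called P X k).
  by apply: (@measurableI _ (g_sigma_algebraType _));
    [exact: no_failure_history|exact: called_history].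
have mE : measurable (no_failure k `&` meo_called P X k) := proj1 A4 k _ hE.
have := proj2 A4 k _ hE (@subIsetr _ _ _).
have -> : no_failure k `&` meo_called P X k `&` meo_failed f P C X k =
    no_failure k `&` failed k.
  by rewrite -setIA (setIidr (@failed_called k)).
have le_E : (Pr (no_failure k `&` meo_called P X k) <= Pr (no_failure k))%E.
  by rewrite le_measure ?inE// => w [].
move: le_E IH; rewrite -(fineK (finite _ mS)) -(fineK (finite _ mE)).
rewrite -(fineK (finite _ mSF)) -EFinM !lee_fin.
set q := fine (Pr (no_failure k)) => le_E IH fail.
have := ler_wpM2l d0 le_E; have d1' : 0 <= 1 - delta by rewrite subr_ge0 ltW.
have := ler_wpM2l d1' IH; rewrite exprS; move: ((1 - delta) ^+ k) => a /=; lra.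
Qed.

End Survival.

Theorem corollary5p14 (R : realType) (n : nat) (f : 'cV[R]_n -> R)
    (P : params R) (x0 : 'cV[R]_n) (Lg LH flow Ug UH delta : R)
    (Cmeo : R -> R -> R)
    (dsp : measure_display) (Omega : measurableType dsp)
    (Pr : probability Omega R) (X : Omega -> run R n)
    (n_gt0 : (0 < n)%N)
    (eps_g01 : 0 < eps_g P < 1) (theta01 : 0 < theta P < 1)
    (x0_gt0 : positive_vec x0)
    (zeta_r01 : 0 < zeta_r P < 1) (zeta_bar01 : 0 < zeta_bar P < 1)
    (beta_range : Num.sqrt (eps_g P) <= beta P < 1)
    (eta01 : 0 < decr_eta P < 1)
    (hMhat : Mhat_valid f P)
    (delta01 : 0 <= delta < 1) (hCmeo : at_most_logarithmic Cmeo)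
    (Lg_gt0 : 0 < Lg) (LH_gt0 : 0 < LH) (Ug_gt0 : 0 < Ug) (UH_gt0 : 0 < UH)
    (hrun : forall w, is_run f P x0 (X w))
    (A1 : forall w, assumption1 f P Lg LH (X w))
    (A2 : assumption2 f flow)
    (A3 : forall w, assumption3 f P Ug UH (X w))
    (A4 : assumption4 f P (Cmeo delta (eps_H P)) Pr X delta)
    (hM : forall w, ccg_M_bounded f P UH (X w)) :
  let C := Cmeo delta (eps_H P) in
  let K := K2 f P LH flow x0 in
  let good := terminates_within f P C UH K
    (fun x => first_order f P x /\ second_order f P x) in
  let bad := terminates_within f P C UH K
    (fun x => first_order f P x /\ ~ second_order f P x) in
  [/\ prob_ge Pr [set w | good (X w)] ((1 - delta) ^+ K),
      prob_le Pr [set w | bad (X w)] (1 - (1 - delta) ^+ K) &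
      forall w,
        (forall k prods, reached P (X w) k ->
           meo_prods (out (X w) k) = Some prods ->
           (prods <= N_meo n P C)%N) ->
        good (X w) \/ bad (X w)].

Proof.
move=> C K good bad.
have terminates w : exists N, terminates_at P (X w) N.
  exact: run_terminates n_gt0 eps_g01 LH_gt0 theta01 eta01 beta_range zeta_r01 zeta_bar01
    hMhat x0_gt0 (hrun w) (A1 w) A2 (A3 w) (hM w).
have reached_K w k : reached P (X w) k -> (k < K)%N.
  exact: reached_lt_K2 n_gt0 eps_g01 LH_gt0 theta01 eta01 beta_range zeta_r01 zeta_bar01
    hMhat x0_gt0 (hrun w) (A1 w) A2 (A3 w) (hM w) _.
have firsto w N : terminates_at P (X w) N -> first_order f P (iterate (X w) N).
  exact: terminates_first_order n_gt0 eps_g01 LH_gt0 theta01 eta01 beta_range zeta_r01 zeta_bar01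
    hMhat x0_gt0 (hrun w) (A1 w) (A3 w) (hM w) _.
have cost w N : terminates_at P (X w) N ->
    (forall k prods, reached P (X w) k -> meo_prods (out (X w) k) = Some prods ->
       (prods <= N_meo n P C)%N) ->
    (total_cost (X w) N <= maxn (2 * minn n (J_max f P UH (X w) N) + 2) (N_meo n P C) * K)%N.
  exact: terminates_cost n_gt0 eps_g01 LH_gt0 theta01 eta01 beta_range zeta_r01 zeta_bar01
    hMhat x0_gt0 (hrun w) (A1 w) A2 (A3 w) (hM w) _ _.
have either w : (forall k prods, reached P (X w) k ->
    meo_prods (out (X w) k) = Some prods -> (prods <= N_meo n P C)%N) ->
    good (X w) \/ bad (X w).
  move=> fast; have [N tN] := terminates w.
  have [so|nso] := pselect (second_order f P (iterate (X w) N)); [left|right];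
    exists N; split=> //;
      [split=> //; exact: firsto|exact: cost|split=> //; exact: firsto|exact: cost].
have good_no_failure : no_failure f P C X K `<=` [set w | good (X w)].
  move=> w nf /=; have [N tN] := terminates w.
  have fast k prods : reached P (X w) k -> meo_prods (out (X w) k) = Some prods ->
      (prods <= N_meo n P C)%N.
    move=> rk Ek; rewrite leqNgt; apply/negP => slow; apply: (nf k (reached_K w k rk)).
    split=> //; move: Ek slow; case: (out (X w) k) => //= [? ? ? ? ? [->]|? [->]] //.
    by left.
  exists N; split=> //; last exact: cost.
  split; first exact: firsto.
  apply: contrapT => nso; apply: (nf N (reached_K w N (proj1 tN))).
  by have [rN [prods E]] := tN; split=> //; rewrite E; right.
split.
- exists (no_failure f P C X K); split=> //; first exact: measurable_no_failure A4 K.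
  exact: prob_no_failure.
- exists (~` no_failure f P C X K); split.
  + exact/measurableC/(measurable_no_failure A4 K).
  (* A false certificate is itself a failure of MEO, at an index below K. *)
  + move=> w [N [tN [_ nso] _]] nf; apply: (nf N (reached_K w N (proj1 tN))).
    by have [rN [prods E]] := tN; split=> //; rewrite E; right.
  + have mS := measurable_no_failure A4 K.
    rewrite probability_setC// EFinB leeB//.
    exact: prob_no_failure.
- exact: either.
Qed.
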